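(* Let $k$ be a finite field, let $n\ge 1$, and let $\mathcal{T}_n$ be the category of finite-dimensional nilpotent $k$-representations of the opposite $\Delta_n^{\mathrm{op}}$ of the cyclic quiver $\Delta_n$. Let $Z$ be a discrete stability function on $\mathcal{T}_n$, and let $$\mathbb{E}_Z:=\prod^{\curvearrowright}_{L\ \text{is }Z\text{-stable},\ \underline{\dim}\,L\ne\delta}\mathbb{E}(y^{\underline{\dim}\,L})\in\hat{\mathbb{T}}_{\Delta_n},$$ where $\delta=(1,1,\dots,1)$, $L$ runs over the isomorphism classes of $Z$-stable objects with $\underline{\dim}\,L\ne\delta$ (there are finitely many), and the factors are multiplied from left to right in the order of decreasing phases. Let $\tau:\hat{\mathbb{T}}_{\Delta_n}\to\hat{\mathbb{T}}_{\Delta_n}$ be the algebra automorphism of order $n$ given by $\tau(y^{\underline{\dim}\,M})=y^{\underline{\dim}\,\tau M}$, induced by the Auslander–Reiten translation $\tau$ of $\mathcal{T}_n$. Then $$\mathbb{E}_Z=\tau(\mathbb{E}_Z)=\cdots=\tau^{n-1}(\mathbb{E}_Z)\quad\text{in }\hat{\mathbb{T}}_{\Delta_n}.$$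
   Context: The cyclic quiver $\Delta_n$ has vertex set $Q_0=\{1,\dots,n\}$ and one arrow from $i$ to $i+1$ for each $i$ (indices modulo $n$). $S_i$ denotes the simple representation of $\Delta_n^{\mathrm{op}}$ (the quiver with arrows $i+1\to i$) at the vertex $i$. The category $\mathcal{T}_n$ is a hereditary abelian category in which every indecomposable object is uniserial and determined up to isomorphism by its socle and its length; the indecomposable of length $2$ with socle $S_i$ has top $S_{i+1}$. Its Grothendieck group is $G_0(\mathcal{T}_n)=\bigoplus_{i=1}^n\mathbb{Z}[S_i]\cong\mathbb{Z}^n$, and the class $[X]$ of an object $X$ corresponds to its dimension vector $\underline{\dim}\,X$. The Auslander–Reiten translation $\tau:\mathcal{T}_n\to\mathcal{T}_n$ is an auto-equivalence of order $n$; on simple objects $\tau S_{i+1}\cong S_i$ (indices modulo $n$), and it induces an automorphism of $G_0(\mathcal{T}_n)$. Stability: a stability function on an abelian category $\mathcal{A}$ is a group homomorphism $Z:G_0(\mathcal{A})\to\mathbb{C}$ such that for each nonzero object $X$ the number $Z([X])$ is nonzero and has argument $\arg Z([X])\in[0,\pi)$; this argument is called the phase of $X$. A nonzero object $X$ is ($Z$-)stable (resp. semi-stable) if every nonzero proper subobject $Y$ of $X$ satisfies $\arg Z([Y])<\arg Z([X])$ (resp. $\le$). For $\mu\in[0,\pi)$, $\mathcal{A}_\mu$ denotes the full subcategory of the zero object and the semi-stable objects of phase $\mu$; it is an abelian subcategory whose simple objects are the stable objects of phase $\mu$. $Z$ is discrete if each $\mathcal{A}_\mu$ is zero or has a unique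 simple object up to isomorphism (equivalently, non-isomorphic stable objects have different phases). Quantum torus: let $\chi([M],[N])=\dim_k\mathrm{Hom}(M,N)-\dim_k\mathrm{Ext}^1(M,N)$ be the Euler form on $G_0(\mathcal{T}_n)$ and $\lambda([M],[N])=\chi([M],[N])-\chi([N],[M])$ its antisymmetrization. Let $q$ be an indeterminate. The completed quantum torus $\hat{\mathbb{T}}_{\Delta_n}=\mathbb{Q}(q^{1/2})[[G_0(\mathcal{T}_n)^+]]$ is the ring of formal power series over $\mathbb{Q}(q^{1/2})$ in the symbols $y^{\underline{\dim}\,M}$, $M\in\mathcal{T}_n$ (i.e. in $y^{d}$, $d\in\mathbb{Z}_{\ge0}^n$), with multiplication determined by $y^{\underline{\dim}\,M}\cdot y^{\underline{\dim}\,N}=q^{\frac12\lambda([M],[N])}\,y^{\underline{\dim}(M\oplus N)}$. Quantum dilogarithm: it is the series $$\mathbb{E}(y)=\sum_{m=0}^{\infty}\frac{q^{m^2/2}}{(q^m-q^{m-1})(q^m-q^{m-2})\cdots(q^m-1)}\,y^m\in\mathbb{Q}(q^{1/2})[[y]],$$ whose $m=0$ term is $1$; $\mathbb{E}(y^{d})$ is obtained by substituting $y^{d}$ for $y$. *)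

(* Defs.v *)
From HB Require Import structures.
From mathcomp Require Import all_boot all_order all_algebra.
From mathcomp Require Import boolp classical_sets functions reals trigo.
From mathcomp Require Import complex.
Set Implicit Arguments.
Unset Strict Implicit.
Unset Printing Implicit Defensive.
Import Order.TTheory GRing.Theory Num.Theory.
Local Open Scope ring_scope.

(* Vertices are 'I_n, with cyclic successor ordS. A representation of the     *)
(* opposite cyclic quiver has one arrow ordS i -> i for each vertex i.        *)
(* Matrices act on row vectors, so the map X_{i+1} -> X_i is v |-> v *m A.    *)
Record rep (k : fieldType) (n : nat) := Rep {
  rdim : 'I_n -> nat;
  rmap : forall i : 'I_n, 'M[k]_(rdim (ordS i), rdim i) }.

Section Category.
Variables (k : fieldType) (n : nat).

(* Action of the path of length m ending at i, from X_{i+m} to X_i. *)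
Fixpoint path_mx (X : rep k n) (i : 'I_n) (m : nat) :
    'M[k]_(rdim X (iter m (@ordS n) i), rdim X i) :=
  if m is m'.+1 then rmap X (iter m' (@ordS n) i) *m path_mx X i m'
  else 1%:M.

Definition nilpotent (X : rep k n) : Prop :=
  exists m, forall i, path_mx X i m = 0.

(* The objects of T_n. *)
Record nilrep := NilRep { nrep :> rep k n; nrepP : nilpotent nrep }.

Definition mxfam (X Y : rep k n) : Type :=
  forall i : 'I_n, 'M[k]_(rdim X i, rdim Y i).

Definition is_hom (X Y : rep k n) (f : mxfam X Y) : Prop :=
  forall i, rmap X i *m f i = f (ordS i) *m rmap Y i.

Definition hom (X Y : rep k n) : Type := {f : mxfam X Y | is_hom f}.

Definition hom_eq (X Y : rep k n) (f g : hom X Y) : Prop :=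
  forall i, sval f i = sval g i.

Definition is_mono (X Y : rep k n) (f : mxfam X Y) : Prop :=
  forall i, row_free (f i).

Definition is_iso (X Y : rep k n) (f : mxfam X Y) : Prop :=
  exists g : mxfam Y X,
    [/\ is_hom g, forall i, f i *m g i = 1%:M & forall i, g i *m f i = 1%:M].

Definition isomorphic (X Y : nilrep) : Prop :=
  exists f : mxfam X Y, is_hom f /\ is_iso f.

Definition is_zero (X : nilrep) : Prop := forall i, rdim X i = 0%N.

(* Short exact sequences 0 -> N -> E -> M -> 0 in T_n. *)
Record extension (M N : nilrep) := Extension {
  ext_obj : nilrep;
  ext_inj : mxfam N ext_obj;
  ext_proj : mxfam ext_obj M;
  ext_injP : is_hom ext_inj;
  ext_projP : is_hom ext_proj;
  ext_mono : forall i, row_free (ext_inj i);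
  ext_epi : forall i, row_full (ext_proj i);
  ext_exact : forall i, (ext_inj i :=: kermx (ext_proj i))%MS }.

Definition ext_equiv (M N : nilrep) (E E' : extension M N) : Prop :=
  exists f : mxfam (ext_obj E) (ext_obj E'),
    [/\ is_hom f, is_iso f,
        forall i, ext_inj E i *m f i = ext_inj E' i
      & forall i, f i *m ext_proj E' i = ext_proj E i].

End Category.

Section Euler.
Variables (k : finFieldType) (n : nat).

(* A vector space V over the finite field k has dimension e iff |V| = |k|^e.  *)
(* This gives the dimension of the set of classes of an equivalence relation, *)
(* such as Ext^1, without transporting the vector space structure to it.      *)
Definition has_dim (T : Type) (E : T -> T -> Prop) (e : nat) : Prop :=
  exists phi : 'rV[k]_e -> T,
    (forall u v, E (phi u) (phi v) -> u = v)
    /\ (forall x, exists u, E (phi u) x).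

Definition dim_quot (T : Type) (E : T -> T -> Prop) : nat :=
  xget 0%N [set e | has_dim E e]%classic.

Definition hom_dim (M N : nilrep k n) : nat := dim_quot (@hom_eq k n M N).
Definition ext_dim (M N : nilrep k n) : nat := dim_quot (@ext_equiv k n M N).

Definition euler (M N : nilrep k n) : int := (hom_dim M N)%:Z - (ext_dim M N)%:Z.

End Euler.

Section CategoryTheory.
Variables (k : fieldType) (n : nat).
Implicit Types (M N : nilrep k n).

Lemma is_iso_inv (X Y : rep k n) (f : mxfam X Y) : is_hom f ->
  forall g : mxfam Y X, (forall i, f i *m g i = 1%:M) ->
  (forall i, g i *m f i = 1%:M) -> is_hom g.
Proof.
move=> hf g fg gf i.
rewrite -[LHS]mul1mx -(gf (ordS i)) -mulmxA; congr (_ *m _).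
by rewrite mulmxA -hf -mulmxA fg mulmx1.
Qed.

Lemma ext_equiv_sym M N (E E' : extension M N) : ext_equiv E E' -> ext_equiv E' E.
Proof.
case=> f [hf [g [hg fg gf]] fi fp]; exists g; split => //.
- by exists f; split.
- by move=> i; rewrite -fi -mulmxA fg mulmx1.
- by move=> i; rewrite -fp mulmxA gf mul1mx.
Qed.

Lemma ext_equiv_trans M N (E E' E'' : extension M N) :
  ext_equiv E E' -> ext_equiv E' E'' -> ext_equiv E E''.
Proof.
case=> f [hf [g [hg fg gf]] fi fp] [f' [hf' [g' [hg' fg' gf']] fi' fp']].
exists (fun i => f i *m f' i); split.
- by move=> i; rewrite mulmxA hf -mulmxA hf' mulmxA.
- exists (fun i => g' i *m g i); split.
  + by move=> i; rewrite mulmxA hg' -mulmxA hg mulmxA.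
  + by move=> i; rewrite mulmxA -(mulmxA (f i)) fg' mulmx1 fg.
  + by move=> i; rewrite mulmxA -(mulmxA (g' i)) gf mulmx1 gf'.
- by move=> i; rewrite mulmxA fi fi'.
- by move=> i; rewrite -mulmxA fp' fp.
Qed.

Inductive is_path (X : rep k n) (i : 'I_n) :
    nat -> forall j : 'I_n, 'M[k]_(rdim X j, rdim X i) -> Prop :=
| IsPath0 : is_path 0 1%:M
| IsPathS m j (A : 'M[k]_(rdim X j, rdim X i)) :
    is_path m A -> is_path m.+1 (rmap X j *m A).

Lemma is_pathP (X : rep k n) i m (j : 'I_n) (A : 'M[k]_(rdim X j, rdim X i)) :
  is_path m A ->
  forall Q : forall j : 'I_n, 'M[k]_(rdim X j, rdim X i) -> Prop,
  Q (iter m (@ordS n) i) (path_mx X i m) -> Q j A.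
Proof.
elim=> [|{}m {}j {}A _ IH] Q //= h.
by apply: (IH (fun j B => Q (ordS j) (rmap X j *m B))).
Qed.

Lemma is_path_mx (X : rep k n) i m : is_path m (path_mx X i m).
Proof. by elim: m => [|m IH] /=; constructor. Qed.

Lemma nilpotentP (X : rep k n) :
  nilpotent X <-> exists m, forall i j (A : 'M[k]_(rdim X j, rdim X i)),
    is_path m A -> A = 0.
Proof.
split=> -[m h]; exists m => i; last exact/h/is_path_mx.
by move=> j A /is_pathP/(_ (fun j B => B = 0)) -> //.
Qed.

Lemma path_mx_eq0 (X : rep k n) i m m' : (m <= m')%N ->
  path_mx X i m = 0 -> path_mx X i m' = 0.
Proof.
move=> /subnK <- h; elim: (m' - m)%N => [|t IH] //.
by rewrite addSn /= IH mulmx0.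
Qed.

End CategoryTheory.

Section EulerForm.
Variables (k : finFieldType) (n : nat).
Implicit Types (M N X : nilrep k n).

Lemma has_dim_uniq (T : Type) (E : T -> T -> Prop) e e' :
  (forall x y, E x y -> E y x) -> (forall x y z, E x y -> E y z -> E x z) ->
  has_dim k E e -> has_dim k E e' -> e = e'.
Proof.
move=> sym tr.
wlog le : e e' / (e <= e')%N => [hw|] h h'.
  by case: (leqP e e') => [|/ltnW] l; [exact: hw|apply/esym/hw].
case: h h' => phi [_ sphi] [psi [ipsi _]].
pose g v := sval (cid (sphi (psi v))).
have gP v : E (phi (g v)) (psi v) by rewrite /g; case: cid.
have gi : injective g.
  move=> u v guv; apply: ipsi; apply: (tr _ (phi (g u))); first exact/sym/gP.
  by rewrite guv; exact: gP.
have := leq_card g gi; rewrite !card_mx !mul1n leq_exp2l ?card_finRing_gt1 //.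
by move=> l; apply/eqP; rewrite eqn_leq le l.
Qed.

Lemma dim_quotE (T : Type) (E : T -> T -> Prop) e :
  (forall x y, E x y -> E y x) -> (forall x y z, E x y -> E y z -> E x z) ->
  has_dim k E e -> dim_quot k E = e.
Proof.
move=> sym tr he; rewrite /dim_quot.
by case: xgetP => [x -> hx|/(_ e)//]; apply: has_dim_uniq he.
Qed.

(* The extension with underlying spaces N_i + M_i and off-diagonal part xi. *)
Section Cocycle.
Variables (M N : nilrep k n).
Variable xi : forall i : 'I_n, 'M[k]_(rdim M (ordS i), rdim N i).

Definition cocycle_rep : rep k n :=
  @Rep k n (fun i => (rdim N i + rdim M i)%N)
    (fun i => block_mx (rmap N i) 0 (xi i) (rmap M i)).

Lemma cocycle_path i m : exists B : 'M_(_, _),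
  path_mx cocycle_rep i m = block_mx (path_mx N i m) 0 B (path_mx M i m).
Proof.
elim: m => [|m [B IH]] /=; first by exists 0; rewrite -scalar_mx_block.
by rewrite IH mulmx_block !mulmx0 !mul0mx !addr0 add0r; eexists.
Qed.

Lemma cocycle_nilpotent : nilpotent cocycle_rep.
Proof.
case: (nrepP N) => mN hN; case: (nrepP M) => mM hM.
have /nilpotentP [mM' hM'] := nrepP M.
exists (mM' + (mN + mM))%N => i.
have Z t : path_mx N i (t + (mN + mM)) = 0.
  by apply: (@path_mx_eq0 _ _ _ _ mN) => //; rewrite addnCA leq_addr.
have Z' t : path_mx M i (t + (mN + mM)) = 0.
  apply: (@path_mx_eq0 _ _ _ _ mM) => //.
  by apply: leq_trans (leq_addl _ _); apply: leq_addl.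
suff [A hA ->] : exists2 A, @is_path k n M (iter (mN + mM) (@ordS n) i) mM'
     (iter (mM' + (mN + mM)) (@ordS n) i) A
   & path_mx cocycle_rep i (mM' + (mN + mM))
     = block_mx 0 0 (A *m dlsubmx (path_mx cocycle_rep i (mN + mM))) 0.
  by rewrite (hM' _ _ _ hA) mul0mx; apply: block_mx0.
elim: mM' {hM'} => [|t [A hA IH]].
  exists 1%:M; first by constructor.
  have [B /[dup] e ->] := cocycle_path i (mN + mM).
  by rewrite block_mxKdl mul1mx (Z 0%N) (Z' 0%N).
rewrite !addSn; exists (rmap M _ *m A); first by constructor.
by rewrite [LHS]/= IH mulmx_block !mulmx0 !mul0mx !addr0 add0r mulmxA.
Qed.

Definition cocycle_obj : nilrep k n := NilRep cocycle_nilpotent.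

Definition cocycle_inj : mxfam N cocycle_obj := fun i => row_mx 1%:M 0.
Definition cocycle_proj : mxfam cocycle_obj M := fun i => col_mx 0 1%:M.

Lemma cocycle_injP : is_hom cocycle_inj.
Proof.
move=> i; rewrite /cocycle_inj /= mul_mx_row mulmx1 mulmx0.
by rewrite mul_row_block !mul0mx !mul1mx !addr0.
Qed.

Lemma cocycle_projP : is_hom cocycle_proj.
Proof.
move=> i; rewrite /cocycle_proj /= mul_block_col mul_col_mx.
by rewrite mul1mx mul0mx !mulmx0 !mulmx1 !add0r.
Qed.

Lemma cocycle_mono i : row_free (cocycle_inj i).
Proof.
by apply/row_freeP; exists (col_mx 1%:M 0); rewrite mul_row_col mulmx1 mulmx0 addr0.
Qed.

Lemma cocycle_epi i : row_full (cocycle_proj i).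
Proof.
by apply/row_fullP; exists (row_mx 0 1%:M); rewrite mul_row_col mulmx1 mulmx0 add0r.
Qed.

Lemma cocycle_exact i : (cocycle_inj i :=: kermx (cocycle_proj i))%MS.
Proof.
apply/eqmxP/andP; split.
  by rewrite sub_kermx mul_row_col mul1mx mulmx1 addr0.
set K := kermx _.
have : K *m cocycle_proj i = 0 by apply: mulmx_ker.
rewrite -[K]hsubmxK mul_row_col mulmx0 mulmx1 add0r => ->.
by apply/submxP; exists (lsubmx K); rewrite mul_mx_row mulmx1 mulmx0.
Qed.

Definition cocycle_ext : extension M N :=
  Extension cocycle_injP cocycle_projP cocycle_mono cocycle_epi cocycle_exact.

End Cocycle.

Lemma cocycle_ext_surj M N (E : extension M N) :
  exists xi, ext_equiv (cocycle_ext xi) E.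
Proof.
have [s sp] : exists s : mxfam M (ext_obj E),
    forall i, s i *m ext_proj E i = 1%:M.
  by exists (fun i => pinvmx (ext_proj E i)) => i; apply/mulVpmx/ext_epi.
have ip i : ext_inj E i *m ext_proj E i = 0.
  by apply/eqP; rewrite -sub_kermx (ext_exact E i).
have lift (m : nat) i (A : 'M_(m, _)) : A *m ext_proj E i = 0 ->
    A *m pinvmx (ext_inj E i) *m ext_inj E i = A.
  by move=> h; apply: mulmxKpV; rewrite (ext_exact E i) sub_kermx h.
pose xi i := (s (ordS i) *m rmap (ext_obj E) i - rmap M i *m s i)
             *m pinvmx (ext_inj E i).
exists xi.
pose f : mxfam (cocycle_obj xi) (ext_obj E) := fun i => col_mx (ext_inj E i) (s i).
pose g : mxfam (ext_obj E) (cocycle_obj xi) := fun i =>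
  row_mx ((1%:M - ext_proj E i *m s i) *m pinvmx (ext_inj E i)) (ext_proj E i).
have hf : is_hom f.
  move=> i; rewrite /f /= mul_block_col mul_col_mx mul0mx addr0.
  rewrite ext_injP lift ?subrK//.
  by rewrite mulmxBl -!mulmxA sp mulmx1 (ext_projP E i) mulmxA sp mul1mx subrr.
have fg i : f i *m g i = 1%:M.
  rewrite /f /g mul_col_row ip sp.
  rewrite mulmxA mulmxBr mulmx1 (mulmxA _ (ext_proj E i)) ip mul0mx subr0 mulmxVp ?ext_mono//.
  rewrite mulmxA mulmxBr mulmx1 (mulmxA _ (ext_proj E i)) sp mul1mx subrr mul0mx.
  by rewrite -scalar_mx_block.
have gf i : g i *m f i = 1%:M.
  rewrite /f /g mul_row_col lift ?subrK//.
  by rewrite mulmxBl mul1mx -mulmxA sp mulmx1 subrr.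
exists f; split => //.
- by exists g; split => //; apply: is_iso_inv hf _ fg gf.
- by move=> i; rewrite /f /= mul_row_col mul1mx mul0mx addr0.
- by move=> i; rewrite /f /= mul_col_mx ip sp.
Qed.

Lemma cocycle_extP M N xi xi' :
  ext_equiv (@cocycle_ext M N xi) (cocycle_ext xi') <->
  exists h : mxfam M N, forall i,
    xi i - xi' i = h (ordS i) *m rmap N i - rmap M i *m h i.
Proof.
split.
  case=> f [hf _ fi fp].
  exists (fun i => dlsubmx (f i)) => i.
  have F j : f j = block_mx 1%:M 0 (dlsubmx (f j)) 1%:M.
    have := fi j; have := fp j; rewrite -[f j]submxK /= /cocycle_inj /cocycle_proj.
    rewrite mul_row_block !mul0mx !mul1mx !addr0 => /eqP.
    rewrite mul_block_col !mulmx0 !mulmx1 !add0r => /eqP.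
    case/eq_col_mx=> -> ->; case/eq_row_mx=> -> _.
    by rewrite block_mxKdl.
  have := hf i; rewrite F (F (ordS i)) /= !mulmx_block.
  rewrite !mulmx1 !mulmx0 !mul1mx !mul0mx !addr0 !add0r !block_mxKdl.
  case/eq_block_mx=> _ _ e _.
  by apply/eqP; rewrite subr_eq addrAC eq_sym subr_eq eq_sym e.
case=> h hE.
exists (fun i => block_mx 1%:M 0 (h i) 1%:M).
have hf : @is_hom k n (cocycle_obj xi) (cocycle_obj xi')
    (fun i => block_mx 1%:M 0 (h i) 1%:M).
  move=> i; rewrite /= !mulmx_block.
  rewrite !mulmx1 !mulmx0 !mul1mx !mul0mx !addr0 !add0r.
  congr block_mx.
  by apply/eqP; rewrite -subr_eq addrAC eq_sym -subr_eq eq_sym hE.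
split => //.
- pose g : mxfam (cocycle_obj xi') (cocycle_obj xi) :=
    fun i => block_mx 1%:M 0 (- h i) 1%:M.
  have fg i : (block_mx 1%:M 0 (h i) 1%:M : 'M_(_ + _)) *m g i = 1%:M.
    rewrite mulmx_block !mulmx1 !mulmx0 !mul1mx !mul0mx !addr0 !add0r subrr.
    by rewrite -scalar_mx_block.
  have gf i : g i *m (block_mx 1%:M 0 (h i) 1%:M : 'M_(_ + _)) = 1%:M.
    rewrite mulmx_block !mulmx1 !mulmx0 !mul1mx !mul0mx !addr0 !add0r addNr.
    by rewrite -scalar_mx_block.
  by exists g; split => //; apply: is_iso_inv hf _ fg gf.
- by move=> i; rewrite /= mul_row_block !mul0mx !mul1mx !addr0.
- by move=> i; rewrite /= mul_block_col !mulmx0 !mulmx1 !add0r.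
Qed.

Section Differential.
Variables (M N : nilrep k n).

Local Notation C0 := (\sum_i (rdim M i * rdim N i))%N.
Local Notation C1 := (\sum_i (rdim M (ordS i) * rdim N i))%N.

Definition fam0 (u : 'rV[k]_C0) : mxfam M N := fun i => vec_mx (submxrow u i).
Definition vec0 (f : mxfam M N) : 'rV[k]_C0 := \mxrow_i mxvec (f i).
Definition fam1 (u : 'rV[k]_C1) i : 'M[k]_(rdim M (ordS i), rdim N i) :=
  vec_mx (submxrow u i).
Definition vec1 (f : forall i, 'M[k]_(rdim M (ordS i), rdim N i)) : 'rV[k]_C1 :=
  \mxrow_i mxvec (f i).

Lemma vec0K f i : fam0 (vec0 f) i = f i.
Proof. by rewrite /fam0 /vec0 mxrowK mxvecK. Qed.
Lemma fam0K u : vec0 (fam0 u) = u.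
Proof.
rewrite -[RHS]submxrowK; apply: eq_mxrow => i.
by rewrite /fam0 vec_mxK.
Qed.
Lemma vec1K f i : fam1 (vec1 f) i = f i.
Proof. by rewrite /fam1 /vec1 mxrowK mxvecK. Qed.
Lemma fam1K u : vec1 (fam1 u) = u.
Proof.
rewrite -[RHS]submxrowK; apply: eq_mxrow => i.
by rewrite /fam1 vec_mxK.
Qed.

Lemma fam0_lin a u v i : fam0 (a *: u + v) i = a *: fam0 u i + fam0 v i.
Proof. by rewrite /fam0 -linearP; congr vec_mx; apply/matrixP=> x y; rewrite !mxE. Qed.
Lemma fam1_lin a u v i : fam1 (a *: u + v) i = a *: fam1 u i + fam1 v i.
Proof. by rewrite /fam1 -linearP; congr vec_mx; apply/matrixP=> x y; rewrite !mxE. Qed.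

Lemma fam1B u v i : fam1 (u - v) i = fam1 u i - fam1 v i.
Proof. by rewrite /fam1 -linearB; congr vec_mx; apply/matrixP=> x y; rewrite !mxE. Qed.

Lemma fam1_inj u v : (forall i, fam1 u i = fam1 v i) -> u = v.
Proof.
move=> h; rewrite -(fam1K u) -(fam1K v).
by apply: eq_mxrow => i; rewrite h.
Qed.
Lemma fam0_inj u v : (forall i, fam0 u i = fam0 v i) -> u = v.
Proof.
move=> h; rewrite -(fam0K u) -(fam0K v).
by apply: eq_mxrow => i; rewrite h.
Qed.

Definition dfun (u : 'rV[k]_C0) : 'rV[k]_C1 :=
  vec1 (fun i => fam0 u (ordS i) *m rmap N i - rmap M i *m fam0 u i).

Lemma dfun_linear : linear dfun.
Proof.
move=> a u v; apply: fam1_inj => i.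
rewrite fam1_lin !vec1K !fam0_lin mulmxDl mulmxDr -scalemxAl -scalemxAr.
by rewrite scalerBr opprD !addrA; congr (_ + _); rewrite addrAC.
Qed.

HB.instance Definition _ := GRing.isLinear.Build k 'rV[k]_C0 'rV[k]_C1 _ dfun
  dfun_linear.

Definition dmx := lin1_mx dfun.

Lemma mul_dmx u : u *m dmx = dfun u. Proof. exact: mul_rV_lin1. Qed.

Lemma dfun_eq0 u : dfun u = 0 <-> is_hom (fam0 u).
Proof.
split=> [h i|h].
  have := vec1K (fun i => fam0 u (ordS i) *m rmap N i - rmap M i *m fam0 u i) i.
  rewrite -/(dfun u) h => /esym /eqP.
  have -> : fam1 0 i = 0.
    by rewrite /fam1; apply/matrixP => x y; rewrite !mxE.
  by rewrite subr_eq0 => /eqP ->.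
apply: fam1_inj => i; rewrite vec1K h subrr.
by rewrite /fam1; apply/matrixP => x y; rewrite !mxE.
Qed.

Lemma hom_has_dim : has_dim k (@hom_eq k n M N) (C0 - \rank dmx).
Proof.
rewrite -mxrank_ker; set K := kermx dmx.
have hom_u (u : 'rV_(\rank K)) : is_hom (fam0 (u *m row_base K)).
  apply/dfun_eq0; rewrite -mul_dmx; apply/eqP; rewrite -sub_kermx.
  by apply: submx_trans (submxMl _ _) _; rewrite eq_row_base.
exists (fun u => exist _ _ (hom_u u)); split.
  by move=> u v /= /fam0_inj; apply/row_free_inj/row_base_free.
case=> f hf.
have : (vec0 f <= row_base K)%MS.
  rewrite eq_row_base sub_kermx mul_dmx; apply/eqP/dfun_eq0 => i.
  by rewrite !vec0K.
case/submxP=> u eu; exists u => i /=.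
by rewrite -eu vec0K.
Qed.

Lemma ext_has_dim : has_dim k (@ext_equiv k n M N) (C1 - \rank dmx).
Proof.
rewrite -mxrank_compl; set K := (dmx^C)%MS.
exists (fun u => cocycle_ext (fam1 (u *m row_base K))); split.
  move=> u v /cocycle_extP [h hE].
  have e : (u - v) *m row_base K = vec0 h *m dmx.
    by apply: fam1_inj => i; rewrite mul_dmx vec1K !vec0K -hE mulmxBl fam1B.
  have : ((u - v) *m row_base K <= dmx :&: K)%MS.
    rewrite sub_capmx {1}e submxMl.
    by apply: submx_trans (submxMl _ _) _; rewrite eq_row_base.
  rewrite capmx_compl submx0 => /eqP h0.
  apply/eqP; rewrite -subr_eq0; apply/eqP.
  by apply: (row_free_inj (row_base_free K)); rewrite h0 mul0mx.
move=> E; have [xi hxi] := cocycle_ext_surj E.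
have : (vec1 xi <= row_base K + dmx)%MS.
  rewrite (adds_eqmx (eq_row_base K) (eqmx_refl dmx)) addsmxC.
  by apply: submx_full; apply: addsmx_compl_full.
case/sub_addsmxP=> -[u w] /= e; exists u.
apply: ext_equiv_trans hxi; apply/cocycle_extP.
exists (fam0 (- w)) => i.
rewrite -(vec1K xi i) -fam1B.
rewrite -(vec1K (fun i => fam0 (- w) (ordS i) *m rmap N i - rmap M i *m fam0 (- w) i)).
by rewrite -/(dfun (- w)) -mul_dmx mulNmx e opprD addrA subrr add0r.
Qed.

End Differential.

Lemma eulerE M N :
  euler M N = (\sum_i (rdim M i * rdim N i))%N%:Z
              - (\sum_i (rdim M (ordS i) * rdim N i))%N%:Z.
Proof.
rewrite /euler /hom_dim /ext_dim.
rewrite (dim_quotE _ _ (hom_has_dim M N)); first last.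
- by move=> f g h fg gh i; rewrite fg gh.
- by move=> f g fg i; rewrite fg.
rewrite (dim_quotE (@ext_equiv_sym _ _ M N) (@ext_equiv_trans _ _ M N) (ext_has_dim M N)).
rewrite -!subzn ?rank_leq_row ?rank_leq_col //.
by rewrite opprB addrA subrK.
Qed.

End EulerForm.

Section Lattice.
Variable n : nat.

(* Z_{>=0}^n and the Grothendieck group Z^n. *)
Definition dimvec : Type := {ffun 'I_n -> nat}.
Definition G0 : Type := {ffun 'I_n -> int}.
HB.instance Definition _ := GRing.Nmodule.on dimvec.
HB.instance Definition _ := Choice.on dimvec.
HB.instance Definition _ := GRing.Zmodule.on G0.

Definition dim_of (k : fieldType) (X : rep k n) : dimvec := [ffun i => rdim X i].
Definition class_G0 (k : fieldType) (X : rep k n) : G0 := [ffun i => (rdim X i)%:Z].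

Definition delta : dimvec := [ffun => 1%N].
Definition dim_simple (i : 'I_n) : dimvec := [ffun j => (j == i) : nat].

Definition dim_sub (d e : dimvec) : dimvec := [ffun i => (d i - e i)%N].
Definition below (d : dimvec) : seq dimvec :=
  [seq [ffun i => val (a i)] | a : {dffun forall i : 'I_n, 'I_(d i).+1}].

Lemma mem_below d a : (a \in below d) = [forall i, (a i <= d i)%N].
Proof.
apply/mapP/forallP => [[b _ ->] i|h].
  by rewrite ffunE -ltnS; apply: ltn_ord.
exists ([ffun i => inord (a i)] : {dffun forall i : 'I_n, 'I_(d i).+1}).
  by rewrite mem_enum.
by apply/ffunP => i; rewrite !ffunE /= inordK // ltnS.
Qed.

Lemma below_uniq d : uniq (below d).
Proof.
rewrite map_inj_uniq ?enum_uniq // => a b /ffunP h.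
by apply/ffunP => i; apply: val_inj; have := h i; rewrite !ffunE.
Qed.

Lemma dim_subK d a : a \in below d -> a + dim_sub d a = d.
Proof.
rewrite mem_below => /forallP h; apply/ffunP => i; rewrite !ffunE.
exact: subnKC.
Qed.

Lemma dim_subK' (a b : dimvec) : dim_sub (a + b) a = b.
Proof. by apply/ffunP => i; rewrite !ffunE; exact: addKn. Qed.

Lemma below_add (a b : dimvec) : a \in below (a + b).
Proof. by rewrite mem_below; apply/forallP => i; rewrite ffunE; exact: leq_addr. Qed.

Lemma belowP d a : reflect (exists b, d = a + b) (a \in below d).
Proof.
apply: (iffP idP) => [h|[b ->]]; last exact: below_add.
by exists (dim_sub d a); rewrite dim_subK.
Qed.

Lemma dim_addI (a : dimvec) : injective (fun b : dimvec => a + b).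
Proof. by move=> b c e; rewrite -(dim_subK' a b) e dim_subK'. Qed.

End Lattice.

Section Objects.
Variables (k : fieldType) (n : nat).

Definition ss_rep (d : dimvec n) : rep k n := @Rep k n d (fun i => 0).

Lemma ss_rep_nilpotent d : nilpotent (ss_rep d).
Proof. by exists 1%N => i /=; rewrite mul0mx. Qed.

(* The semisimple object of dimension vector d. *)
Definition ss (d : dimvec n) : nilrep k n := NilRep (ss_rep_nilpotent d).

Definition simple (i : 'I_n) : nilrep k n := ss (dim_simple i).

(* The Auslander-Reiten translation is the rotation auto-equivalence sending  *)
(* S_{i+1} to S_i (see tau_simple); tau_hom is its action on morphisms.       *)
Definition tau_rep (X : rep k n) : rep k n :=
  @Rep k n (fun i => rdim X (ordS i)) (fun i => rmap X (ordS i)).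

Lemma tau_rep_nilpotent (X : nilrep k n) : nilpotent (tau_rep X).
Proof.
have /nilpotentP [m hm] := nrepP X.
apply/nilpotentP; exists m => i j A hA; apply: (hm (ordS i) (ordS j)) => {hm}.
by elim: hA => [|m' j' A' _ IH]; [exact: (@IsPath0 _ _ X (ordS i))
  |exact: (@IsPathS _ _ X (ordS i) m' (ordS j') A' IH)].
Qed.

Definition tau_obj (X : nilrep k n) : nilrep k n := NilRep (tau_rep_nilpotent X).

Definition tau_hom (X Y : nilrep k n) (f : mxfam X Y) :
  mxfam (tau_obj X) (tau_obj Y) := fun i => f (ordS i).

Lemma tau_homP (X Y : nilrep k n) (f : mxfam X Y) : is_hom f -> is_hom (tau_hom f).
Proof. by move=> hf i; apply: hf. Qed.

Lemma tau_simple i : isomorphic (tau_obj (simple (ordS i))) (simple i).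
Proof.
have e j : rdim (tau_obj (simple (ordS i))) j = rdim (simple i) j.
  by rewrite /= !ffunE (inj_eq (@ordS_inj n)).
exists (fun j => castmx (erefl, e j) 1%:M); split.
  by move=> j; rewrite /= mul0mx mulmx0.
exists (fun j => castmx (e j, erefl) 1%:M); split => j.
- by rewrite /= mul0mx mulmx0.
- by move: (e j); case: _ /; rewrite !castmx_id mulmx1.
- by move: (e j); case: _ /; rewrite !castmx_id mulmx1.
Qed.

End Objects.

Section Torus.
Variables (k : finFieldType) (n : nat).
Implicit Types (a b c d e : dimvec n).

(* The Euler form on Z_{>=0}^n, computed on semisimple representatives.       *)
Definition chi d e : int := euler (ss k d) (ss k e).
Definition lam d e : int := chi d e - chi e d.

Lemma chiP (M N : nilrep k n) : chi (dim_of M) (dim_of N) = euler M N.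
Proof.
rewrite /chi !eulerE /=; congr (Posz _ - Posz _);
by apply: eq_bigr => i _; rewrite !ffunE.
Qed.

Lemma chiE d e : chi d e = \sum_i ((d i)%:Z * (e i)%:Z - (d (ordS i))%:Z * (e i)%:Z).
Proof.
rewrite /chi eulerE /= sumrB !(big_morph Posz PoszD (erefl _)).
by congr (_ - _); apply: eq_bigr => i _; rewrite PoszM.
Qed.

Lemma dimD a b i : (a + b) i = (a i + b i)%N.
Proof. by rewrite ffunE. Qed.

Lemma chiDl a b c : chi (a + b) c = chi a c + chi b c.
Proof.
rewrite !chiE -big_split /=; apply: eq_bigr => i _.
by rewrite !dimD !PoszD !mulrDl opprD addrACA.
Qed.

Lemma chiDr a b c : chi c (a + b) = chi c a + chi c b.
Proof.
rewrite !chiE -big_split /=; apply: eq_bigr => i _.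
by rewrite !dimD !PoszD !mulrDr opprD addrACA.
Qed.

Lemma lamDl a b c : lam (a + b) c = lam a c + lam b c.
Proof. by rewrite /lam chiDl chiDr opprD addrACA. Qed.

Lemma lamDr a b c : lam c (a + b) = lam c a + lam c b.
Proof. by rewrite /lam chiDl chiDr opprD addrACA. Qed.

Lemma lam0l c : lam 0 c = 0.
Proof. by apply: (@addrI _ (lam 0 c)); rewrite -lamDl !addr0. Qed.

Lemma lam0r c : lam c 0 = 0.
Proof. by apply: (@addrI _ (lam c 0)); rewrite -lamDr !addr0. Qed.

End Torus.

(* Q(q^{1/2}), with q^{1/2} the indeterminate. *)
Definition Kq : fieldType := {fraction {poly rat}}.
Definition qhalf : Kq := tofrac (polyX rat).
Definition qpar : Kq := qhalf ^+ 2.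

Lemma qhalf_neq0 : qhalf != 0.
Proof. by rewrite /qhalf tofrac_eq0 polyX_eq0. Qed.

(* Formal power series in the y^d, as families of coefficients. *)
Definition qtorus (k : finFieldType) (n : nat) : Type := dimvec n -> Kq.

HB.instance Definition _ (k : finFieldType) (n : nat) :=
  GRing.Zmodule.copy (qtorus k n) (dimvec n -> Kq).

Section TorusRing.
Variables (k : finFieldType) (n : nat).
Implicit Types (a b c d e : dimvec n) (f g h : qtorus k n).

Definition ymon d : qtorus k n := fun e => if e == d then 1 else 0.

Definition qmul f g : qtorus k n := fun d =>
  \sum_(a <- below d)
    qhalf ^ lam k a (dim_sub d a) * (f a * g (dim_sub d a)).

Lemma qtorusD f g d : (f + g) d = f d + g d. Proof. by []. Qed.

Lemma twDl a b c :
  qhalf ^ lam k (a + b) c = qhalf ^ lam k a c * qhalf ^ lam k b c.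
Proof. by rewrite lamDl expfzDr ?qhalf_neq0. Qed.

Lemma twDr a b c :
  qhalf ^ lam k c (a + b) = qhalf ^ lam k c a * qhalf ^ lam k c b.
Proof. by rewrite lamDr expfzDr ?qhalf_neq0. Qed.

Lemma qmulA : associative qmul.
Proof.
move=> f g h; apply/funext => d; rewrite /qmul.
pose F (p : dimvec n * dimvec n) : Kq :=
  let: (a, b) := p in let c := dim_sub (dim_sub d a) b in
  qhalf ^ lam k a b * qhalf ^ lam k a c * qhalf ^ lam k b c * (f a * g b * h c).
transitivity (\sum_(p <- [seq (a, b) | a <- below d, b <- below (dim_sub d a)]) F p).
  rewrite big_allpairs_dep; apply: eq_big_seq => a; rewrite /F => /belowP[u ->].
  rewrite dim_subK' mulrA big_distrr; apply: eq_big_seq => b /belowP[v ->] /=.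
  rewrite !dim_subK' twDr.
  by rewrite -!mulrA; do 2 congr (_ * _); rewrite mulrCA.
transitivity (\sum_(p <- [seq (a, dim_sub c a) | c <- below d, a <- below c]) F p).
  apply: perm_big; apply: uniq_perm.
  - apply: allpairs_uniq_dep => //; first exact: below_uniq.
      by move=> a _; exact: below_uniq.
    by move=> [a b] [a' b'] _ _ /= [-> ->].
  - apply: allpairs_uniq_dep => //; first exact: below_uniq.
      by move=> a _; exact: below_uniq.
    move=> [c a] [c' a'] /allpairsPdep[x [y [_ hy [-> ->]]]].
    move=> /allpairsPdep[x' [y' [_ hy' [-> ->]]]] /= [yy'].
    rewrite -yy' in hy' *; move=> e.
    by rewrite -(dim_subK hy) -(dim_subK hy') e.
  move=> [a b]; apply/allpairsPdep/allpairsPdep => -[x [y [hx hy [-> ->]]]].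
    case/belowP: hx hy => u ->; rewrite dim_subK' => /belowP[v ->].
    exists (x + y), x; rewrite dim_subK' below_add; split=> //.
    by rewrite addrA below_add.
  case/belowP: hx => u ->; case/belowP: hy => v ->.
  exists y, v; rewrite dim_subK'; split => //.
    by rewrite -addrA below_add.
  by rewrite -addrA dim_subK' below_add.
rewrite big_allpairs_dep; apply: eq_big_seq => c; rewrite /F => /belowP[u ->].
rewrite dim_subK' big_distrl big_distrr; apply: eq_big_seq => a /belowP[v ->] /=.
rewrite -addrA !dim_subK' twDl.
rewrite (mulrC (qhalf ^ lam k a v)) -!mulrA.
by congr (_ * _); rewrite mulrCA; congr (_ * _); rewrite mulrA.
Qed.

Lemma below0 d : 0 \in below d.
Proof. by apply/belowP; exists d; rewrite add0r. Qed.

Lemma below_id d : d \in below d.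
Proof. by apply/belowP; exists 0; rewrite addr0. Qed.

Lemma dim_sub0 d : dim_sub d 0 = d.
Proof. by rewrite -{1}(add0r d) dim_subK'. Qed.

Lemma dim_subdd d : dim_sub d d = 0.
Proof. by rewrite -{1}(addr0 d) dim_subK'. Qed.

Lemma qmul1 : left_id (ymon 0) qmul.
Proof.
move=> f; apply/funext => d; rewrite /qmul (bigD1_seq 0) ?below0 ?below_uniq //=.
rewrite /ymon eqxx dim_sub0 lam0l expr0z !mul1r big1 ?addr0 // => a /negPf ->.
by rewrite mul0r mulr0.
Qed.

Lemma qmulr1 : right_id (ymon 0) qmul.
Proof.
move=> f; apply/funext => d; rewrite /qmul (bigD1_seq d) ?below_id ?below_uniq //=.
rewrite /ymon dim_subdd eqxx lam0r expr0z mul1r mulr1 big_seq_cond big1 ?addr0 //.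
move=> a /andP[/belowP[b ->]]; rewrite dim_subK' => ne.
by case: eqP => [b0|_]; [rewrite b0 addr0 eqxx in ne | rewrite !mulr0].
Qed.

Lemma qmulDl : left_distributive qmul +%R.
Proof.
move=> f g h; apply/funext => d; rewrite /qmul [RHS]qtorusD -big_split /=.
by apply: eq_bigr => a _; rewrite qtorusD mulrDl mulrDr.
Qed.

Lemma qmulDr : right_distributive qmul +%R.
Proof.
move=> f g h; apply/funext => d; rewrite /qmul [RHS]qtorusD -big_split /=.
by apply: eq_bigr => a _; rewrite qtorusD !mulrDr.
Qed.

Lemma qone_neq0 : ymon 0 != 0 :> qtorus k n.
Proof.
apply/eqP => /(congr1 (fun f : qtorus k n => f 0)).
by rewrite /ymon eqxx => /eqP; rewrite oner_eq0.
Qed.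

HB.instance Definition _ := GRing.Zmodule_isNzRing.Build (qtorus k n)
  qmulA qmul1 qmulr1 qmulDl qmulDr qone_neq0.

Lemma qtorusM f g d : (f * g) d = \sum_(a <- below d)
  qhalf ^ lam k a (dim_sub d a) * (f a * g (dim_sub d a)).
Proof. by []. Qed.

Lemma ymonM d e :
  ymon d * ymon e = (fun c => qhalf ^ lam k d e * ymon (d + e) c) :> qtorus k n.
Proof.
apply/funext => c; rewrite qtorusM /ymon.
case: (boolP (d \in below c)) => [/belowP[u ->]|hd].
  rewrite (bigD1_seq d) ?below_add ?below_uniq //= eqxx dim_subK' mul1r big1 ?addr0.
    rewrite (inj_eq (@dim_addI _ d)).
    by case: eqP => [->|]; rewrite ?mulr0.
  by move=> a /negPf ->; rewrite mul0r mulr0.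
rewrite big_seq big1 => [|a ha].
  case: eqP => [e'|]; last by rewrite mulr0.
  by rewrite e' below_add in hd.
by case: eqP => [e'|]; [rewrite -e' ha in hd|rewrite mul0r mulr0].
Qed.

(* The coefficients of the quantum dilogarithm. *)
Definition qdilog_coef (m : nat) : Kq :=
  qhalf ^+ (m ^ 2) / \prod_(j < m) (qpar ^+ m - qpar ^+ j).

(* E(y^d) = \sum_m qdilog_coef m (y^d)^m for d <> 0. As (y^d)^m only involves *)
(* the exponent m d, the coefficient of y^e is a sum over m <= e_1 + .. + e_n. *)
Definition qdilog d : qtorus k n := fun e =>
  \sum_(m < (\sum_i e i).+1) qdilog_coef m * (ymon d ^+ m : qtorus k n) e.

(* tau_dim is the action of tau_obj on dimension vectors (dim_of_tau), and tau  *)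
(* sends y^d to y^(tau_dim d) (tau_ymon), so that it moves coefficients along *)
(* the inverse of tau_dim.                                                    *)
Definition tau_dim d : dimvec n := [ffun i => d (ordS i)].
Definition tau_dimV d : dimvec n := [ffun i => d (ord_pred i)].
Definition tau f : qtorus k n := fun d => f (tau_dimV d).

Lemma tau_dimK : cancel tau_dim tau_dimV.
Proof. by move=> d; apply/ffunP => i; rewrite !ffunE ord_predK. Qed.
Lemma tau_dimVK : cancel tau_dimV tau_dim.
Proof. by move=> d; apply/ffunP => i; rewrite !ffunE ordSK. Qed.

Lemma dim_of_tau (X : nilrep k n) : dim_of (tau_obj X) = tau_dim (dim_of X).
Proof. by apply/ffunP => i; rewrite !ffunE. Qed.

Lemma tau_ymon d : tau (ymon d) = ymon (tau_dim d).
Proof.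
apply/funext => e; rewrite /tau /ymon.
by rewrite -(can_eq tau_dimK) tau_dimVK.
Qed.

Lemma tau_dimVD a b : tau_dimV (a + b) = tau_dimV a + tau_dimV b.
Proof. by apply/ffunP => i; rewrite !ffunE. Qed.

Lemma chi_tau a b : chi k (tau_dimV a) (tau_dimV b) = chi k a b.
Proof.
rewrite !chiE (reindex_inj (@ordS_inj n)); apply: eq_bigr => i _ /=.
by rewrite !ffunE !ordSK.
Qed.

Lemma tau_is_additive : zmod_morphism tau.
Proof. by move=> f g; apply/funext. Qed.

Lemma tau_is_multiplicative : monoid_morphism tau.
Proof.
split; first by rewrite tau_ymon; congr ymon; apply/ffunP => i; rewrite !ffunE.
move=> f g; apply/funext => d; rewrite /tau [LHS]qtorusM [RHS]qtorusM.
rewrite (perm_big (map tau_dimV (below d))); last first.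
  apply: uniq_perm; rewrite ?below_uniq ?(map_inj_uniq (can_inj tau_dimVK)) ?below_uniq //.
  move=> a; apply/belowP/mapP => [[b e]|[b /belowP[c ->] ->]].
    exists (tau_dim a); rewrite ?tau_dimK //; apply/belowP; exists (tau_dim b).
    by rewrite -(tau_dimVK d) e; apply/ffunP => i; rewrite !ffunE.
  by exists (tau_dimV c); rewrite tau_dimVD.
rewrite big_map; apply: eq_big_seq => a /belowP[b ->].
by rewrite tau_dimVD !dim_subK' /lam !chi_tau.
Qed.

HB.instance Definition _ :=
  GRing.isZmodMorphism.Build (qtorus k n) (qtorus k n) tau tau_is_additive.
HB.instance Definition _ :=
  GRing.isMonoidMorphism.Build (qtorus k n) (qtorus k n) tau tau_is_multiplicative.

End TorusRing.

Section Argument.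
Variable R : realType.
Implicit Types z : R[i].

Definition cabs z : R := Num.sqrt (complex.Re z ^+ 2 + complex.Im z ^+ 2).

(* Principal argument, in ]-pi, pi]. *)
Definition carg z : R :=
  let t := acos (complex.Re z / cabs z) in
  if 0 <= complex.Im z then t else - t.

Lemma cargP z : z != 0 ->
  z = (cabs z * cos (carg z) +i* (cabs z * sin (carg z)))%C
  /\ - pi < carg z <= pi.
Proof.
case: z => x y z0; rewrite /carg /cabs /=.
set r2 := x ^+ 2 + y ^+ 2; set r := Num.sqrt r2.
have r2_gt0 : 0 < r2.
  rewrite lt0r addr_ge0 ?sqr_ge0 // andbT; apply: contra_neq z0 => /eqP.
  by rewrite paddr_eq0 ?sqr_ge0 // !sqrf_eq0 => /andP[/eqP-> /eqP->].
have r_gt0 : 0 < r by rewrite sqrtr_gt0.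
have rr : r ^+ 2 = r2 by rewrite sqr_sqrtr // ltW.
have xr : - r <= x <= r.
  rewrite -ler_norml -sqrtr_sqr; apply: ler_wsqrtr.
  by rewrite lerDl sqr_ge0.
have c1 : -1 <= x / r <= 1.
  by rewrite ler_pdivlMr // ler_pdivrMr // mulN1r mul1r.
have rc : r * cos (acos (x / r)) = x.
  by rewrite acosK ?in_itv //= mulrC divfK // gt_eqF.
have rs : r * sin (acos (x / r)) = `|y|.
  rewrite sin_acos //; apply/eqP.
  rewrite -{1}(ger0_norm (ltW r_gt0)) -(sqrtr_sqr r) -sqrtrM ?sqr_ge0 //.
  rewrite -(sqrtr_sqr y); apply/eqP; congr Num.sqrt.
  rewrite mulrBr mulr1 -exprMn mulrCA mulfV ?gt_eqF // mulr1 rr /r2.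
  by rewrite addrAC subrr add0r.
have a0 := acos_ge0 c1; have api := acos_lepi c1.
case: ifP => [y0|/negbT]; last first.
  rewrite -ltNge => y0; rewrite cosN sinN mulrN rc rs ltr0_norm // opprK; split=> //.
  have ltpi : acos (x / r) < pi.
    rewrite lt_neqAle api andbT; apply/eqP => e.
    by move: rs; rewrite e sinpi mulr0 ltr0_norm // => /esym/eqP; rewrite oppr_eq0 lt_eqF.
  by rewrite ltrN2 ltpi /= (le_trans _ (pi_ge0 R)) // oppr_le0.
rewrite rc rs ger0_norm //; split=> //; rewrite api andbT.
by apply: lt_le_trans a0; rewrite oppr_lt0 pi_gt0.
Qed.

End Argument.

Section Stability.
Variables (R : realType) (k : finFieldType) (n : nat).
Variable Z : {additive G0 n -> R[i]}.
Implicit Types X Y L S : nilrep k n.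

Definition phase X : R := carg (Z (class_G0 X)).

Definition stability_function : Prop :=
  forall X, ~ is_zero X -> Z (class_G0 X) != 0 /\ 0 <= phase X < pi.

Definition stable X : Prop :=
  ~ is_zero X /\
  forall Y (f : mxfam Y X), is_hom f -> is_mono f -> ~ is_iso f ->
    ~ is_zero Y -> phase Y < phase X.

Definition semistable X : Prop :=
  ~ is_zero X /\
  forall Y (f : mxfam Y X), is_hom f -> is_mono f -> ~ is_iso f ->
    ~ is_zero Y -> phase Y <= phase X.

(* The objects of the full subcategory A_mu. *)
Definition in_slice (mu : R) X : Prop :=
  is_zero X \/ semistable X /\ phase X = mu.

Definition slice_simple (mu : R) X : Prop :=
  [/\ in_slice mu X, ~ is_zero X
    & forall Y (f : mxfam Y X), in_slice mu Y -> is_hom f -> is_mono f ->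
      is_zero Y \/ is_iso f].

Definition discrete : Prop :=
  forall mu : R, 0 <= mu < pi ->
    (forall X, in_slice mu X -> is_zero X) \/
    exists S, slice_simple mu S /\
      forall S', slice_simple mu S' -> isomorphic S' S.

(* L enumerates, by strictly decreasing phases (hence without repetition),    *)
(* the isomorphism classes of stable objects of dimension vector <> delta.    *)
Definition stable_listing (m : nat) (L : 'I_m -> nilrep k n) : Prop :=
  [/\ forall i, stable (L i) /\ dim_of (L i) <> delta n,
      forall X, stable X -> dim_of X <> delta n -> exists i, isomorphic X (L i)
    & forall i j : 'I_m, (i < j)%N -> phase (L j) < phase (L i)].

End Stability.

(* The product is taken from left to right, in the order of the indices. *)
Definition EZ (k : finFieldType) (n m : nat) (L : 'I_m -> nilrep k n) :
  qtorus k n := \prod_(i < m) qdilog k (dim_of (L i)).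

(* Main.v *)
From HB Require Import structures.
Require Import Defs.
From mathcomp Require Import all_boot all_order all_algebra.
From mathcomp Require Import zify ring lra.
From mathcomp Require Import boolp reals trigo complex.
Set Implicit Arguments.
Unset Strict Implicit.
Unset Printing Implicit Defensive.
Import Order.TTheory GRing.Theory Num.Theory.
Local Open Scope ring_scope.

(** Write [E_t] for the dilogarithm of the simple at the vertex [t]. By the
pentagon identity, the ordered product over the stable objects supported on an
interval [p, q) of fewer than [n] consecutive vertices is [E_p ... E_(q-1)],
whatever the stability function: this is seen by sweeping a phase threshold.
Discreteness gives a vertex [s] whose uniserial object of class [delta] is stable;
number the vertices from [s]. No other stable object passes over [s], and cutting
the product at the phase of that object yields
  [E_Z = (E_1 ... E_(n-1)) (E_1 ... E_(n-2))^-1 (E_0 ... E_(n-2))].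
By the pentagon identity again, this element does not depend on [s], whereas [tau]
shifts [s] by one. *)

(** * Stable arcs of a phase function *)

(** The pentagon identity requires [lam] = 1. This holds for consecutive arcs [c, x) and [x, d) when
    d < c + n; when d = c + n they touch at both ends and [lam] = 0. The interval formula is
    therefore out of reach for the whole cycle [0, n), and the product has to be recovered from the
    intervals [1, n) and [0, n-1) and their overlap [1, n-1). A phase order may interleave the arcs
    in many ways. The sweep copes with all of them by carrying E_m leftwards through the product for
    [p, m): the pentagon identity spawns arcs ending in m+1, and each is dropped at the place that
    its phase prescribes. Phases enter only through the seesaw property. On the side of
    representations, no classification of the indecomposables is used. The class of a stable object
    is found from its endomorphisms, which are injective or zero. *)

Lemma iota_split1 p m c : (p <= c <= m)%N ->
  iota p (m.+1 - p) = iota p (c - p) ++ c :: iota c.+1 (m - c).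
Proof.
move=> cb; have -> : (m.+1 - p = (c - p) + (m - c).+1)%N by lia.
by rewrite iotaD /=; congr (_ ++ _ :: iota _.+1 _); lia.
Qed.

Section Sweep.
Variables (R : realDomainType) (W : nzRingType) (n : nat).
Variables (phi : nat -> nat -> R) (E : nat -> nat -> W).

(** [c, d) stands for the uniserial object with composition factors at c, ..., d-1, read from the
    socle. Its nonzero proper subobjects are the prefixes [c, x), with quotients [x, d). *)
Definition arc_stable (c d : nat) : bool :=
  (c < d)%N && all (fun x => phi c x < phi c d) (iota c.+1 (d - c.+1)).

Lemma arc_stableP c d : reflect
  ((c < d)%N /\ forall x, (c < x < d)%N -> phi c x < phi c d) (arc_stable c d).
Proof.
apply: (iffP andP) => -[cd h]; split=> //.
  by move=> x xb; apply: (allP h); rewrite mem_iota; lia.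
by apply/allP => x; rewrite mem_iota => xb; apply: h; lia.
Qed.

Definition seesaw : Prop := forall c x d, (c < x < d)%N ->
  [/\ phi c x < phi x d -> phi c x < phi c d < phi x d,
      phi x d < phi c x -> phi x d < phi c d < phi c x
    & phi c x = phi x d -> phi c d = phi c x].

Hypothesis phiP : seesaw.

Lemma seesaw_le c x d mu : (c < x < d)%N ->
  phi c x <= mu -> phi x d <= mu -> phi c d <= mu.
Proof.
move=> /phiP [h1 h2 h3] a b.
case: (ltgtP (phi c x) (phi x d)) => [/h1/andP[_ /ltW h]|/h2/andP[_ /ltW h]|/h3 ->] //;
  exact: le_trans h _.
Qed.

Lemma seesaw_gt_r c x d mu : (c < x < d)%N ->
  phi c x <= mu -> mu < phi c d -> mu < phi x d.
Proof. by move=> xb a; rewrite !ltNge; apply: contra; exact: seesaw_le. Qed.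

Lemma seesaw_le_r c x d mu : (c < x < d)%N ->
  mu <= phi c x -> phi c d <= mu -> phi x d <= mu.
Proof.
move=> /phiP [h1 h2 h3] a b.
case: (ltgtP (phi c x) (phi x d)) => [/h1/andP[h _]|/h2/andP[h _]|h].
- by have := lt_le_trans h b; rewrite ltNge a.
- by apply: ltW; apply: lt_le_trans h b.
- by rewrite -h -(h3 h).
Qed.

Lemma stable_quotient c x d : arc_stable c d -> (c < x < d)%N -> phi c d < phi x d.
Proof.
move=> /arc_stableP[_ st] xb; have sub := st _ xb; have [h1 _ _] := phiP xb.
have lt : phi c x < phi x d.
  rewrite ltNge; apply/negP => le; have := seesaw_le xb (lexx _) le.
  by rewrite leNgt sub.
by have /andP[] := h1 lt.
Qed.

(* z is the shortest prefix of maximal phase. *)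
Lemma stable_prefix c e mu y : (c < y <= e)%N -> mu < phi c y ->
  exists2 z, (c < z <= e)%N & [/\ arc_stable c z, mu < phi c z &
    forall x, (c < x <= e)%N -> phi c x <= phi c z].
Proof.
move=> yb muy.
have [z zb [zmax zmin]] : exists2 z, (c < z <= e)%N &
   (forall x, (c < x <= e)%N -> phi c x <= phi c z) /\
   (forall x, (c < x < z)%N -> phi c x < phi c z).
  move: yb => {muy} yb; have {y yb} : (c < e)%N by lia.
  elim: e => [//|e IH] ce.
  have [ce'|ce'] := ltnP c e; last first.
    exists e.+1; first lia.
    by split=> x xb; [have -> : x = e.+1 by lia|lia].
  have [z zb [zmax zmin]] := IH ce'.
  have [lez|ltz] := leP (phi c e.+1) (phi c z).
    exists z; first lia.
    split=> // x xb; have [->//|xe] := eqVneq x e.+1.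
    by apply: zmax; lia.
  exists e.+1; first lia.
  split=> x xb; last by apply: le_lt_trans ltz; apply: zmax; lia.
  have [->//|xe] := eqVneq x e.+1.
  by apply: ltW; apply: le_lt_trans ltz; apply: zmax; lia.
exists z => //; split=> //; last by apply: lt_le_trans muy _; exact: zmax.
by apply/arc_stableP; split=> //; lia.
Qed.

Section Interval.
Variable p : nat.

Hypothesis E_pentagon : forall c x d, (p <= c)%N -> (c < x < d)%N ->
  (d < p + n)%N -> E c x * E x d = E x d * E c d * E c x.
Hypothesis E_disjoint : forall c d c' d', (p <= c < d)%N -> (d < c' < d')%N ->
  (d' < p + n)%N -> E c d * E c' d' = E c' d' * E c d.
Hypothesis E_nested : forall c d c' d', (p <= c < c')%N -> (c' < d' < d)%N ->
  (d < p + n)%N -> E c' d' * E c d = E c d * E c' d'.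

Section Step.
Variable m : nat.
Hypothesis pm : (p <= m)%N.
Hypothesis mn : (m.+1 < p + n)%N.
Variable s : seq (nat * nat).
Hypothesis s_sorted : sorted (fun L M => phi M.1 M.2 < phi L.1 L.2) s.
Hypothesis sP : forall c d,
  ((c, d) \in s) = [&& (p <= c)%N, (d <= m.+1)%N & arc_stable c d].

(* The arcs [c, m+1) created by the pentagon identity once E_m has moved left   *)
(* past all the arcs of phase <= mu, and which still have to move further.      *)
Definition active mu c := (mu < phi c m.+1) &&
  all (fun y => phi c y <= mu) (iota c.+1 (m - c)).

Lemma activeP mu c : reflect
  (mu < phi c m.+1 /\ forall y, (c < y <= m)%N -> phi c y <= mu) (active mu c).
Proof.
apply: (iffP andP) => -[h1 h]; split=> //.
  by move=> x xb; apply: (allP h); rewrite mem_iota; lia.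
by apply/allP => x; rewrite mem_iota => xb; apply: h; lia.
Qed.

(** The starts decrease because the pentagon identity turns E(x, y) E(y, m+1) into E(y, m+1) E(x,
    m+1) E(x, y): the new arc, of smaller start, comes second. *)
Definition active_prod mu :=
  \prod_(c <- rev (iota p (m.+1 - p)) | active mu c) E c m.+1.

Section Crossing.
Variables (x y : nat) (mu0 mu : R).
Hypothesis Ls : (x, y) \in s.
Hypothesis mu0L : mu0 < phi x y.
Hypothesis Lmu : phi x y <= mu.
Hypothesis gap : forall c d, (c, d) \in s ->
  [\/ phi c d <= mu0, (c, d) = (x, y) | mu < phi c d].

Let mu0mu : mu0 <= mu. Proof. exact: ltW (lt_le_trans mu0L Lmu). Qed.

Let Lb : (p <= x < y)%N && (y <= m.+1)%N.
Proof. by move: Ls; rewrite sP => /and3P[-> -> /arc_stableP[->]]. Qed.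

Let L_arc : arc_stable x y.
Proof. by move: Ls; rewrite sP => /and3P[]. Qed.

Let L_stable z : (x < z < y)%N -> phi x z < phi x y.
Proof. by case/arc_stableP: L_arc => _; apply. Qed.

(** By [gap], [x, y) is the only arc of s with phase in the window (mu0, mu]. A prefix violating the
    bound would give, through [stable_prefix], another stable arc in that window. *)
Lemma gap_le c e : (p <= c)%N -> (e <= m.+1)%N ->
  (forall z, (c < z <= e)%N -> phi c z <= mu) ->
  forall z, (c < z <= e)%N -> phi c z <= if c == x then phi x y else mu0.
Proof.
move=> pc em h z zb; rewrite leNgt; apply/negP => hz.
have [z' zb' [st gt_mu _]] := stable_prefix zb hz.
have /gap : (c, z') \in s by rewrite sP st pc; lia.
move: gt_mu; case: eqVneq => [ecx|cx] gt_mu [] //.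
- by move=> le0; move: (lt_le_trans gt_mu le0); rewrite ltNge (ltW mu0L).
- by case=> _ yz; move: gt_mu; rewrite ecx yz ltxx.
- by rewrite ltNge h.
- by move=> le0; move: (lt_le_trans gt_mu le0); rewrite ltxx.
- by case=> e'; rewrite e' eqxx in cx.
- by rewrite ltNge h.
Qed.

Lemma active_neq c : (p <= c <= m)%N -> c != x -> active mu0 c = active mu c.
Proof.
move=> /andP[pc cm] /negPf cx; apply/activeP/activeP => -[gt_mu h].
  have h' z : (c < z <= m)%N -> phi c z <= mu.
    by move=> zb; apply: le_trans (h z zb) mu0mu.
  split=> //; rewrite ltNge; apply/negP => le_mu.
  have hm z : (c < z <= m.+1)%N -> phi c z <= mu.
    by move=> zb; have [->//|zm] := eqVneq z m.+1; apply: h'; lia.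
  have := gap_le pc (leqnn _) hm (_ : c < m.+1 <= m.+1)%N; rewrite cx.
  by rewrite leNgt gt_mu => /(_ ltac:(lia)).
split; first exact: le_lt_trans mu0mu gt_mu.
by move=> z zb; have := gap_le pc (leqnSn m) h zb; rewrite cx.
Qed.

(** For c > x, [c, y) is a quotient of the stable arc [x, y), so its phase also exceeds mu0. Hence
    no factor of [active_prod] separates the starts y and x, and the pentagon identity applies to
    neighbours. *)
Lemma inactive_inside c : (y <= m)%N -> (x <= c < y)%N -> active mu0 c = false.
Proof.
move=> ym cb; apply/negP => /activeP[_ /(_ y ltac:(lia))]; rewrite leNgt.
have [->|cx] := eqVneq c x; first by rewrite mu0L.
rewrite (lt_trans mu0L) //; apply: (stable_quotient L_arc); lia.
Qed.

(** The pentagon identity creates [x, m+1) when [x, y) meets the active arc [y, m+1), and only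
    then. *)
Lemma active_source : (y <= m)%N -> active mu x = active mu0 y.
Proof.
move=> ym; rewrite (@active_neq y) //; try lia.
apply/activeP/activeP => -[gt_mu h].
  have hL z : (x < z <= m)%N -> phi x z <= phi x y.
    move=> zb; have := @gap_le x m ltac:(lia) (leqnSn m) h z zb.
    by rewrite eqxx.
  split; first by apply: seesaw_gt_r gt_mu; rewrite // ; lia.
  move=> z zb; apply: le_trans Lmu.
  by apply: seesaw_le_r (lexx _) (hL z _); lia.
have h' z : (x < z <= m)%N -> phi x z <= mu.
  move=> zb; have [zy|yz|->] := ltngtP z y; last exact: Lmu.
    by apply: le_trans Lmu; apply: ltW; apply: L_stable; lia.
  by apply: (@seesaw_le x y z) => //; [lia|apply: h; lia].
split=> //; rewrite ltNge; apply/negP => le_mu.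
have hm z : (x < z <= m.+1)%N -> phi x z <= mu.
  by move=> zb; have [->//|zm] := eqVneq z m.+1; apply: h'; lia.
have := @gap_le x m.+1 ltac:(lia) (leqnn _) hm m.+1 ltac:(lia).
rewrite eqxx => le; move: gt_mu; rewrite ltNge => /negP; apply.
by apply: le_trans Lmu; apply: seesaw_le_r (lexx _) le; lia.
Qed.

(** Here the threshold reaches the phase of [x, m+1) itself, which ceases to be active. It is the
    last factor, since by the seesaw property no start below x is active, so it can be split off on
    the right. *)
Lemma active_prod_top : y = m.+1 -> active_prod mu0 = active_prod mu * E x y.
Proof.
move=> ym; have xb : (p <= x <= m)%N by lia.
rewrite /active_prod (iota_split1 xb) rev_cat rev_cons !big_cat /= -cats1 !big_cat /=.
have low c : c \in rev (iota p (x - p)) -> active mu c = false.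
  rewrite mem_rev mem_iota => cb; apply/negP => act.
  have := act; rewrite -active_neq; try lia.
  case/activeP: act => gt_mu _ /activeP[_ /(_ x ltac:(lia)) le0].
  have := @seesaw_le c x m.+1 mu ltac:(lia) (le_trans le0 mu0mu).
  by rewrite -ym => /(_ Lmu); rewrite leNgt ym gt_mu.
have eq_lists : \prod_(c <- rev (iota x.+1 (m - x)) | active mu0 c) E c m.+1 =
                \prod_(c <- rev (iota x.+1 (m - x)) | active mu c) E c m.+1.
  rewrite big_seq_cond [RHS]big_seq_cond; apply: eq_bigl => c.
  case: (boolP (c \in _)) => //=; rewrite mem_rev mem_iota => cb.
  by rewrite active_neq; lia.
have act_x : active mu0 x.
  apply/activeP; split; first by rewrite -ym.
  move=> z zb; rewrite leNgt; apply/negP => gt0.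
  have [z' zb' [st gt0' _]] := stable_prefix zb gt0.
  have /gap [] : (x, z') \in s by rewrite sP st; lia.
  - by rewrite leNgt gt0'.
  - by case; lia.
  - by rewrite ltNge (le_trans _ Lmu) // ltW // L_stable; lia.
have inact_x : active mu x = false.
  by apply/negP => /activeP[]; rewrite -ym ltNge Lmu.
have lo mu' : mu' = mu0 \/ mu' = mu ->
    \prod_(c <- rev (iota p (x - p)) | active mu' c) E c m.+1 = 1.
  move=> mu'E; rewrite big_seq_cond big1 // => c /andP[cl].
  suff -> : active mu' c = false by [].
  case: mu'E => ->; last exact: low.
  by rewrite active_neq ?low //; move: cl; rewrite mem_rev mem_iota; lia.
rewrite eq_lists !big_cons !big_nil act_x inact_x !lo ?mulr1 ?ym //; first by right.
by left.
Qed.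

(** The active arcs [c, m+1) with c > y are separated from [x, y), and those with c < x contain it
    with room on both sides: all of these commute with E(x, y). Only c = y, if active, calls for the
    pentagon identity. *)
Lemma active_prod_cross : (y <= m)%N -> E x y * active_prod mu0 = active_prod mu * E x y.
Proof.
move=> ym; have xb : (p <= x <= m)%N by lia.
rewrite /active_prod (iota_split1 xb).
have -> : (m - x = (y - x.+1) + (m - y).+1)%N by lia.
rewrite iotaD /= (_ : (x.+1 + (y - x.+1) = y)%N); last lia.
set lo := iota p _; set mid := iota x.+1 _; set hi := iota y.+1 _.
rewrite !(rev_cat, rev_cons) !big_cat /= -!cats1 !big_cat /= !big_cons !big_nil.
have in_x : active mu0 x = false by apply: inactive_inside => //; lia.
rewrite (active_source ym) in_x.
rewrite -(@active_neq y); [|lia|by apply/eqP; lia].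
have mid1 mu' : mu' = mu0 \/ mu' = mu ->
    \prod_(c <- rev mid | active mu' c) E c m.+1 = 1.
  move=> mu'E; rewrite big_seq_cond big1 // => c; rewrite mem_rev mem_iota.
  move=> /andP[cb]; suff -> : active mu' c = false by [].
  have in0 : active mu0 c = false by apply: inactive_inside => //; lia.
  by case: mu'E => ->; rewrite // -active_neq //; lia.
have eq_lists l : (forall c, c \in l -> [&& p <= c, c <= m & c != x]%N) ->
   \prod_(c <- l | active mu c) E c m.+1 = \prod_(c <- l | active mu0 c) E c m.+1.
  move=> lP; rewrite big_seq_cond [RHS]big_seq_cond; apply: eq_bigl => c.
  case: (boolP (c \in _)) => //= /lP /and3P[pc cm cx].
  by rewrite -active_neq // pc.
rewrite !mid1; [|by right|by left].
rewrite !(eq_lists (rev _)); first last.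
- by move=> c; rewrite mem_rev mem_iota; lia.
- by move=> c; rewrite mem_rev mem_iota; lia.
set H := \prod_(c <- rev hi | _) _; set K := \prod_(c <- rev lo | _) _.
have cH : GRing.comm (E x y) H.
  rewrite /H big_seq_cond; apply: commr_prod => c; rewrite mem_rev mem_iota => /andP[cb _].
  by apply: E_disjoint; lia.
have cK : GRing.comm (E x y) K.
  rewrite /K big_seq_cond; apply: commr_prod => c; rewrite mem_rev mem_iota => /andP[cb _].
  by apply: E_nested; lia.
rewrite !mulr1; case: (active mu0 y); last by rewrite !mulr1 !mulrA cH -!mulrA cK.
rewrite !mulrA cH -!mulrA; congr (_ * _).
by rewrite -cK !mulrA E_pentagon //; lia.
Qed.

End Crossing.

Lemma below_threshold (l : seq (nat * nat)) (t : R) :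
  (forall M, M \in l -> phi M.1 M.2 < t) ->
  exists2 mu, mu < t & forall M, M \in l -> phi M.1 M.2 <= mu.
Proof.
elim: l => [_|M l IH h]; first by exists (t - 1); rewrite // ltrBlDr ltrDl ltr01.
have [|mu mut hl] := IH; first by move=> N Nl; apply: h; rewrite inE Nl orbT.
exists (Num.max mu (phi M.1 M.2)); first by rewrite gt_max mut h ?mem_head.
move=> N; rewrite inE le_max => /predU1P[->|/hl ->//]; by rewrite lexx orbT.
Qed.

(** [active_prod mu] is what E_m has become after crossing the tail s1 of arcs of phase at most mu.
    The induction starts below all phases: every simple [c, c+1) then has phase above mu, so only
    the start m is active and the product is E_m itself. *)
Lemma sweep s1 : forall s2 mu, s = s2 ++ s1 ->
  (forall L, L \in s2 -> mu < phi L.1 L.2) ->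
  (forall L, L \in s1 -> phi L.1 L.2 <= mu) ->
  (\prod_(L <- s1 | (L.2 <= m)%N) E L.1 L.2) * E m m.+1 =
  active_prod mu * \prod_(L <- s1) E L.1 L.2.
Proof.
elim: s1 => [|[x y] s1 IH] s2 mu es gt_mu le_mu.
  rewrite cats0 in es; rewrite !big_nil mul1r mulr1 /active_prod.
  have simple c : (p <= c <= m)%N -> mu < phi c c.+1.
    move=> cb; apply: (gt_mu (c, c.+1)); rewrite -es sP.
    by apply/and3P; split; [lia|lia|apply/arc_stableP; split; lia].
  rewrite (@iota_split1 p m m) ?pm ?leqnn // subnn cats1 rev_rcons big_cons.
  have -> : active mu m by apply/activeP; split; [apply: simple; lia|lia].
  rewrite big_seq_cond big1 ?mulr1 // => c; rewrite mem_rev mem_iota => /andP[cb].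
  move=> /activeP[_ /(_ c.+1 ltac:(lia))]; rewrite leNgt simple //; lia.
have Ls : (x, y) \in s by rewrite es mem_cat mem_head orbT.
have xyb : (y <= m.+1)%N by move: Ls; rewrite sP => /and3P[].
have srt : forall M, M \in s1 -> phi M.1 M.2 < phi x y.
  move: s_sorted; rewrite es => /cat_sorted2[_] /=.
  rewrite (path_sortedE (leT := fun L M => phi M.1 M.2 < phi L.1 L.2)).
    by move=> /andP[/allP h _].
  by move=> a b c h1 h2; exact: lt_trans h2 h1.
have [mu0 mu0L le0] := below_threshold srt.
have Lmu : phi x y <= mu by apply: (le_mu (x, y)); rewrite mem_head.
have gap c d : (c, d) \in s -> [\/ phi c d <= mu0, (c, d) = (x, y) | mu < phi c d].
  rewrite es mem_cat => /orP[/gt_mu|]; first by constructor 3.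
  by rewrite inE => /predU1P[->|/le0]; [constructor 2|constructor 1].
have {IH} := IH (rcons s2 (x, y)) mu0; rewrite cat_rcons => /(_ es) IH.
have {}IH := IH _ le0.
rewrite !big_cons /=; case: (leqP y m) => ym.
  rewrite -mulrA IH ?mulrA ?(active_prod_cross Ls mu0L Lmu gap ym) //.
  move=> L; rewrite mem_rcons inE => /predU1P[->//|/gt_mu].
  by apply: lt_trans; exact: lt_le_trans mu0L Lmu.
rewrite IH ?mulrA -?(active_prod_top Ls mu0L Lmu gap) //; first lia.
move=> L; rewrite mem_rcons inE => /predU1P[->//|/gt_mu].
by apply: lt_trans; exact: lt_le_trans mu0L Lmu.
Qed.

Lemma above_threshold (l : seq (nat * nat)) :
  exists mu, forall M, M \in l -> phi M.1 M.2 <= mu.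
Proof.
elim: l => [|M l [mu hl]]; first by exists 0.
exists (Num.max mu (phi M.1 M.2)) => N.
by rewrite inE le_max => /predU1P[->|/hl ->//]; rewrite lexx orbT.
Qed.

Lemma interval_step :
  \prod_(L <- s) E L.1 L.2 = (\prod_(L <- s | (L.2 <= m)%N) E L.1 L.2) * E m m.+1.
Proof.
have [mu hmu] := above_threshold s.
(* At a threshold above all phases nothing is active: an active start would give, by
   [stable_prefix], an arc of s of still larger phase. *)
rewrite (@sweep s [::] mu) //; have -> : active_prod mu = 1; last by rewrite mul1r.
rewrite /active_prod big_seq_cond big1 // => c.
rewrite mem_rev mem_iota => /andP[cb /activeP[gt_mu _]].
have cm : (c < m.+1 <= m.+1)%N by lia.
have [z zb [st gt_z _]] := stable_prefix cm gt_mu.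
have : (c, z) \in s by rewrite sP st; lia.
by move/(hmu (c, z)); rewrite leNgt gt_z.
Qed.

End Step.

Lemma interval_prod q s : (p <= q)%N -> (q < p + n)%N ->
  sorted (fun L M => phi M.1 M.2 < phi L.1 L.2) s ->
  (forall c d, ((c, d) \in s) = [&& (p <= c)%N, (d <= q)%N & arc_stable c d]) ->
  \prod_(L <- s) E L.1 L.2 = \prod_(p <= t < q) E t t.+1.
Proof.
elim: q s => [|q IH] s pq qn srt sP.
  case: s sP {srt} => [|[c d] s] sP; first by rewrite big_nil big_geq.
  have := mem_head (c, d) s; rewrite sP => /and3P[_ d0 /arc_stableP[]]; lia.
have [pq'|pq'] := ltnP q p.
  have -> : s = [::].
    case: s sP {srt} => [//|[c d] s] sP.
    have := mem_head (c, d) s; rewrite sP => /and3P[pc dq /arc_stableP[]]; lia.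
  by rewrite big_nil big_geq.
rewrite (interval_step pq' qn srt sP) big_nat_recr //= -big_filter; congr (_ * _).
apply: IH => //; first lia.
  by apply: sorted_filter srt => a b c h1 h2; exact: lt_trans h2 h1.
by move=> c d; rewrite mem_filter sP /=; lia.
Qed.

End Interval.
End Sweep.

Lemma prod_cut (R : realDomainType) (W : nzRingType) (T : eqType) (f : T -> R)
    (F : T -> W) (P : pred T) (s : seq T) (mu : R) :
  sorted (fun a b => f b < f a) s ->
  \prod_(a <- s | P a) F a =
  (\prod_(a <- s | P a && (mu < f a)) F a) * \prod_(a <- s | P a && (f a <= mu)) F a.
Proof.
elim: s => [|a s IH] srt; first by rewrite !big_nil mulr1.
rewrite !big_cons IH ?(path_sorted srt) //.
have [fa|fa] := ltP mu (f a); case: (P a); rewrite ?mulrA //= .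
have ltfa b : b \in s -> f b < f a.
  move: srt; rewrite /= (path_sortedE (leT := fun a b => f b < f a)).
    by case/andP => /allP h _; exact: h.
  by move=> x y z h1 h2; exact: lt_trans h2 h1.
by rewrite big_seq_cond big1 ?mulr1 ?mul1r // => b /and3P[/ltfa ba _];
   rewrite ltNge (le_trans (ltW ba) fa).
Qed.

(** * Cutting at the phase of the stable object of class delta, and rotation *)

Section Cut.
Variables (R : realDomainType) (W : unitRingType) (n : nat).
Variables (phi : nat -> nat -> R) (E : nat -> nat -> W).
Hypothesis phiP : seesaw phi.
Hypothesis n_gt0 : (0 < n)%N.
Hypothesis E_unit : forall c d, E c d \is a GRing.unit.
Hypothesis E_pentagon : forall c x d, (c < x < d)%N -> (d < c + n)%N ->
  E c x * E x d = E x d * E c d * E c x.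
Hypothesis E_disjoint : forall c d c' d', (c < d)%N -> (d < c' < d')%N ->
  (d' < c + n)%N -> E c d * E c' d' = E c' d' * E c d.
Hypothesis E_nested : forall c d c' d', (c < c')%N -> (c' < d' < d)%N ->
  (d < c + n)%N -> E c' d' * E c d = E c d * E c' d'.

Definition simple_prod p q := \prod_(p <= t < q) E t t.+1.

Lemma simple_prod_unit p q : simple_prod p q \is a GRing.unit.
Proof. by apply: rpred_prod => t _; exact: E_unit. Qed.

Lemma interval_filter s p q : (p <= q <= n)%N -> (q < p + n)%N ->
  sorted (fun L M => phi M.1 M.2 < phi L.1 L.2) s ->
  (forall c d, ((c, d) \in s) =
    [&& (d <= n)%N, (c, d) != (0, n)%N & arc_stable phi c d]) ->
  \prod_(L <- s | (p <= L.1)%N && (L.2 <= q)%N) E L.1 L.2 = simple_prod p q.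
Proof.
move=> pq qn srt sP; rewrite -big_filter.
apply: (@interval_prod R W n phi E phiP p) => //; try lia.
- by move=> c x d *; apply: E_pentagon; lia.
- by move=> c d c' d' *; apply: E_disjoint; lia.
- by move=> c d c' d' *; apply: E_nested; lia.
- by apply: sorted_filter srt => a b c h1 h2; exact: lt_trans h2 h1.
move=> c d; rewrite mem_filter sP /= -andbA.
have [pc|] := leqP p c => //=; have [dq|] := leqP d q => //=.
have -> : (d <= n)%N by lia.
by have -> : (c, d) != (0, n)%N by apply/eqP => -[]; lia.
Qed.

(* Cutting at the phase mu of the stable arc [0, n): the stable arcs of phase *)
(* > mu start after 0, and those ending in n have phase > mu.                 *)
Lemma stable_prod s : arc_stable phi 0 n -> (1 < n)%N ->
  sorted (fun L M => phi M.1 M.2 < phi L.1 L.2) s ->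
  (forall c d, ((c, d) \in s) =
    [&& (d <= n)%N, (c, d) != (0, n)%N & arc_stable phi c d]) ->
  \prod_(L <- s) E L.1 L.2 =
  simple_prod 1 n * (simple_prod 1 n.-1)^-1 * simple_prod 0 n.-1.
Proof.
move=> st0n n1 srt sP; have /arc_stableP[_ st] := st0n.
pose mu := phi 0 n.
have suffix x : (0 < x < n)%N -> mu < phi x n by exact: stable_quotient.
have hiP L : L \in s -> mu < phi L.1 L.2 -> (0 < L.1)%N.
  case: L => [[|c] d] //=; rewrite sP => /and3P[dn ne /arc_stableP[d0 _]].
  have [e|ne'] := eqVneq d n; first by rewrite e eqxx in ne.
  by rewrite ltNge ltW //; apply: st; lia.
have loP L : L \in s -> phi L.1 L.2 <= mu -> (L.2 <= n.-1)%N.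
  case: L => [c d] /=; rewrite sP => /and3P[dn ne /arc_stableP[cd _]].
  have [e|ne'] := eqVneq d n; last by lia.
  move: ne cd; rewrite e leNgt => ne cd; rewrite suffix // cd andbT.
  by case: c ne {cd} => //; rewrite eqxx.
have pE (P Q : pred (nat * nat)) : {in s, P =1 Q} ->
    \prod_(L <- s | P L) E L.1 L.2 = \prod_(L <- s | Q L) E L.1 L.2.
  move=> PQ; rewrite big_seq_cond [RHS]big_seq_cond; apply: eq_bigl => L.
  by case: (boolP (L \in s)) => //= /PQ.
have sn L : L \in s -> (L.2 <= n)%N by case: L => c d; rewrite sP => /andP[].
have cut (P : pred _) := prod_cut (fun L => E L.1 L.2) P mu srt.
pose A := \prod_(L <- s | mu < phi L.1 L.2) E L.1 L.2.
pose B := \prod_(L <- s | phi L.1 L.2 <= mu) E L.1 L.2.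
pose mid (L : nat * nat) := (1 <= L.1)%N && (L.2 <= n.-1)%N.
pose a := \prod_(L <- s | mid L && (mu < phi L.1 L.2)) E L.1 L.2.
pose b := \prod_(L <- s | mid L && (phi L.1 L.2 <= mu)) E L.1 L.2.
have unit_sub (P : pred _) : \prod_(L <- s | P L) E L.1 L.2 \is a GRing.unit.
  by apply: rpred_prod => L _; exact: E_unit.
have eAB : \prod_(L <- s) E L.1 L.2 = A * B by rewrite (cut xpredT).
(* The three intervals give A b, a B and a b, whence A B = (A b) (a b)^-1 (a B). *)
have eAb : simple_prod 1 n = A * b.
  rewrite -(interval_filter _ _ srt sP); [|lia|lia]; rewrite cut.
  congr (_ * _); apply: pE => L Ls; rewrite /mid sn // andbT.
    by case: ltP (hiP L Ls) => [_ ->|]; rewrite ?andbF.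
  by case: leP (loP L Ls) => [_ ->|]; rewrite ?andbF ?andbT.
have eaB : simple_prod 0 n.-1 = a * B.
  rewrite -(interval_filter _ _ srt sP); [|lia|lia]; rewrite cut.
  congr (_ * _); apply: pE => L Ls; rewrite /mid /=.
    by case: ltP (hiP L Ls) => [_ ->|]; rewrite ?andbF ?andbT.
  by case: leP (loP L Ls) => [_ ->|]; rewrite ?andbF ?andbT.
have eab : simple_prod 1 n.-1 = a * b.
  by rewrite -(interval_filter _ _ srt sP); [rewrite cut|lia|lia].
have [ua ub] : a \is a GRing.unit /\ b \is a GRing.unit by split; apply: unit_sub.
by rewrite eAB eAb eaB eab invrM // !mulrA mulrK // mulrVK.
Qed.

(** By descending induction x = E(n-1, n) E(n-2, n) ... E(c+1, n). All factors but the last are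
    separated from [c, c+1) and commute with E_c; the last one gives the pentagon identity. The
    condition 0 < c keeps [c, n) shorter than n. *)
Lemma conj_simple c : (c.+1 < n)%N ->
  let x := simple_prod c.+1 n.-1 * E n.-1 n * (simple_prod c.+1 n.-1)^-1 in
  (0 < c)%N -> E c c.+1 * x = x * E c n * E c c.+1.
Proof.
have [k] := ubnP (n - c); elim: k => // k IH in c * => ck cn /= c0.
have [e|ne] := eqVneq c.+1 n.-1.
  rewrite e /simple_prod big_geq // mul1r invr1 mulr1.
  by have := @E_pentagon c n.-1 n; rewrite e => -> //; lia.
have := IH c.+1 ltac:(lia) ltac:(lia) isT.
set y := _ * _^-1 => IHc.
have -> : simple_prod c.+1 n.-1 * E n.-1 n * (simple_prod c.+1 n.-1)^-1 = y * E c.+1 n.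
  have -> : simple_prod c.+1 n.-1 = E c.+1 c.+2 * simple_prod c.+2 n.-1.
    by rewrite /simple_prod big_ltn //; lia.
  rewrite invrM ?E_unit ?simple_prod_unit // -(mulrK (E_unit c.+1 c.+2) (y * _)) -IHc.
  by rewrite /y !mulrA.
have cy : GRing.comm (E c c.+1) y.
  have cR : GRing.comm (E c c.+1) (simple_prod c.+2 n.-1).
    rewrite /simple_prod big_seq_cond; apply: commr_prod => t.
    rewrite mem_index_iota => /andP[tb _]; apply: E_disjoint; lia.
  by apply: commrM; [apply: commrM => //; apply: E_disjoint; lia|exact: commrV].
rewrite mulrA cy -!mulrA; congr (_ * _).
by rewrite E_pentagon // ?mulrA //; lia.
Qed.

(* Writing R = E_2 .. E_{n-2} and x = R E_{n-1} R^-1, both sides are equal to *)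
(* x E_0 x^-1 E_1 x R, because x^-1 E_1 x E_1^-1 = E(1,n) commutes with E_0.  *)
Lemma rotation : (2 < n)%N ->
  (forall t, (1 < t < n.-1)%N -> GRing.comm (E 0 1) (E t t.+1)) ->
  GRing.comm (E 0 1) (E 1 n) ->
  simple_prod 1 n * (simple_prod 1 n.-1)^-1 * simple_prod 0 n.-1 =
  (simple_prod 2 n * E 0 1) * (simple_prod 2 n)^-1 * simple_prod 1 n.
Proof.
move=> n2 c0t c01n.
have := @conj_simple 1 ltac:(lia) isT; set x := _ * _^-1 => cx.
pose r := simple_prod 2 n.-1; pose e := E n.-1 n.
have er : simple_prod 2 n = r * e.
  rewrite /simple_prod (_ : n = n.-1.+1); last lia.
  by rewrite big_nat_recr /= ?prednK //; lia.
have e1r : simple_prod 1 n.-1 = E 1 2 * r by rewrite /simple_prod big_ltn //; lia.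
have e1 : simple_prod 1 n = E 1 2 * (r * e) by rewrite -er /simple_prod big_ltn //; lia.
have e0 : simple_prod 0 n.-1 = E 0 1 * (E 1 2 * r).
  by rewrite -e1r /simple_prod big_ltn //; lia.
have ur : r \is a GRing.unit by exact: simple_prod_unit.
have ue : e \is a GRing.unit by exact: E_unit.
have u1 : E 1 2 \is a GRing.unit by exact: E_unit.
have xr : r * e = x * r by rewrite /x mulrVK.
have ux : x \is a GRing.unit by rewrite /x !unitrMl ?unitrV.
have c0r : GRing.comm (E 0 1) r.
  rewrite /r /simple_prod big_seq_cond; apply: commr_prod => t.
  by rewrite mem_index_iota => /andP[tb _]; exact: c0t.
clearbody x r e.
have lhs : E 1 2 * (x * r) / (E 1 2 * r) = x * E 1 n.
  by rewrite mulrA cx -(mulrA _ (E 1 2)) mulrK // unitrMl.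
have rhs : x * r * E 0 1 / (x * r) = x * E 0 1 / x.
  by rewrite -(mulrA x r) -c0r invrM // !mulrA mulrK.
rewrite er e1r e1 e0 xr lhs rhs (mulrA (E 1 2) x) cx !mulrA mulrVK //.
by rewrite -(mulrA x) -c01n !mulrA.
Qed.

End Cut.

(** * The quantum torus as an algebra *)

Section TorusAlgebra.
Variables (k : finFieldType) (n : nat).
Implicit Types (a b d e : dimvec n) (f g h : qtorus k n) (c : Kq).

Definition qscale c f : qtorus k n := fun d => c * f d.

Lemma qscaleA c c' f : qscale c (qscale c' f) = qscale (c * c') f.
Proof. by apply/funext => d; rewrite /qscale mulrA. Qed.

Lemma qscale1 : left_id 1 qscale.
Proof. by move=> f; apply/funext => d; rewrite /qscale mul1r. Qed.

Lemma qscaleDr : right_distributive qscale +%R.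
Proof. by move=> c f g; apply/funext => d; rewrite /qscale !qtorusD mulrDr. Qed.

Lemma qscaleDl f : {morph qscale^~ f : c c' / c + c'}.
Proof. by move=> c c'; apply/funext => d; rewrite /qscale qtorusD mulrDl. Qed.

HB.instance Definition _ := GRing.Zmodule_isLmodule.Build Kq (qtorus k n)
  qscaleA qscale1 qscaleDr qscaleDl.

Lemma qtorusZ c f d : (c *: f) d = c * f d. Proof. by []. Qed.

Lemma qscaleAl c f g : c *: (f * g) = c *: f * g.
Proof.
apply/funext => d; rewrite qtorusZ !qtorusM big_distrr.
by apply: eq_bigr => a _; rewrite /= qtorusZ -[c * f a * _]mulrA mulrCA.
Qed.

HB.instance Definition _ := GRing.Lmodule_isLalgebra.Build Kq (qtorus k n) qscaleAl.

Lemma qscaleAr c f g : c *: (f * g) = f * (c *: g).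
Proof.
apply/funext => d; rewrite qtorusZ !qtorusM big_distrr.
by apply: eq_bigr => a _; rewrite /= qtorusZ mulrCA; congr (_ * _); rewrite mulrCA.
Qed.

HB.instance Definition _ := GRing.Lalgebra_isAlgebra.Build Kq (qtorus k n) qscaleAr.

(** The unit ring structure is obtained by classical choice; [qunit_const1] supplies the units. *)
Definition qunit : pred (qtorus k n) := fun f => `[< exists g, g * f = 1 /\ f * g = 1 >].

Definition qinv f : qtorus k n :=
  if pselect (exists g, g * f = 1 /\ f * g = 1) is left h then sval (cid h) else f.

Lemma qmulVr : {in qunit, left_inverse 1 qinv *%R}.
Proof.
by move=> f /asboolP h; rewrite /qinv; case: pselect => // h'; case: cid => g [].
Qed.

Lemma qmulrV : {in qunit, right_inverse 1 qinv *%R}.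
Proof.
by move=> f /asboolP h; rewrite /qinv; case: pselect => // h'; case: cid => g [].
Qed.

Lemma qunitPl f g : g * f = 1 /\ f * g = 1 -> qunit f.
Proof. by move=> h; apply/asboolP; exists g. Qed.

Lemma qinv_out : {in [predC qunit], qinv =1 id}.
Proof. by move=> f /asboolP h; rewrite /qinv; case: pselect. Qed.

HB.instance Definition _ := GRing.NzRing_hasMulInverse.Build (qtorus k n)
  qmulVr qmulrV qunitPl qinv_out.

Definition deg d : nat := \sum_i d i.

Lemma degD a b : deg (a + b) = (deg a + deg b)%N.
Proof. by rewrite /deg -big_split; apply: eq_bigr => i _; exact: dimD. Qed.

Lemma deg_eq0 d : (deg d == 0%N) = (d == 0).
Proof.
rewrite /deg sum_nat_eq0; apply/forallP/eqP => [h|-> i]; last by rewrite ffunE.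
by apply/ffunP => i; rewrite ffunE; apply/eqP/h.
Qed.

(** Congruence modulo the series of order > N. It is compatible with products, which reduces
    identities between dilogarithms to finite sums. *)
Definition eqdeg N f g : Prop := forall d, (deg d <= N)%N -> f d = g d.

Lemma eqdegM N f g f' g' : eqdeg N f f' -> eqdeg N g g' -> eqdeg N (f * g) (f' * g').
Proof.
move=> hf hg d hd; rewrite !qtorusM; apply: eq_big_seq => a /belowP[b ed].
by move: hd; rewrite ed degD dim_subK' => hd; rewrite hf ?hg //; lia.
Qed.

Lemma eqdeg_eq f g : (forall N, eqdeg N f g) -> f = g.
Proof. by move=> h; apply/funext => d; apply: (h (deg d)). Qed.

Lemma low_degM i j f g : (forall d, (deg d < i)%N -> f d = 0) ->
  (forall d, (deg d < j)%N -> g d = 0) -> forall d, (deg d < i + j)%N -> (f * g) d = 0.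
Proof.
move=> hf hg d hd; rewrite qtorusM big_seq big1 // => a /belowP[b ed].
move: hd; rewrite ed degD dim_subK' => hd.
have [ai|ai] := ltnP (deg a) i; first by rewrite hf // mul0r mulr0.
by rewrite (hg b) ?mulr0 //; lia.
Qed.

Lemma low_degX j f : f 0 = 0 -> forall d, (deg d < j)%N -> (f ^+ j) d = 0.
Proof.
move=> f0; elim: j => [//|j IH]; rewrite exprS -add1n.
by apply: low_degM IH => d; rewrite ltnS leqn0 deg_eq0 => /eqP ->.
Qed.

Lemma qtorusN f d : (- f) d = - f d. Proof. by []. Qed.

Lemma qtorus10 : (1 : qtorus k n) 0 = 1.
Proof. by rewrite -[LHS]/(ymon k 0 0) /ymon eqxx. Qed.

Lemma qsumE (I : Type) (r : seq I) (P : pred I) (F : I -> qtorus k n) d :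
  (\sum_(i <- r | P i) F i) d = \sum_(i <- r | P i) F i d.
Proof. by elim/big_rec2: _ => // i x f _ <-; rewrite qtorusD. Qed.

Lemma qunit_const1 f : f 0 = 1 -> f \is a GRing.unit.
Proof.
move=> f0; pose u := 1 - f.
have u0 : u 0 = 0 by rewrite /u qtorusD qtorusN qtorus10 f0 subrr.
pose gN N : qtorus k n := \sum_(j < N.+1) u ^+ j.
(* The inverse is the geometric series in u. As u^j vanishes in degrees below j, its coefficient at
   d is already that of the truncation at [deg d]. *)
pose g : qtorus k n := fun d => gN (deg d) d.
have gE N : eqdeg N g (gN N).
  move=> d hd; rewrite /g /gN !qsumE -!(big_mkord xpredT (fun j => (u ^+ j) d)).
  rewrite [RHS](big_cat_nat _ (n := (deg d).+1)) //= [X in _ + X]big_nat.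
  by rewrite [X in _ + X]big1 ?addr0 // => j /andP[hj _]; apply: low_degX.
have fE : f = 1 - u by rewrite /u opprB addrCA subrr addr0.
have small N : eqdeg N (1 - u ^+ N.+1) 1.
  by move=> d hd; rewrite qtorusD qtorusN low_degX // subr0.
have cf N : f * gN N = 1 - u ^+ N.+1.
  by rewrite fE /gN -(opprB u 1) mulNr -subrX1 opprB.
have cg N : gN N * f = 1 - u ^+ N.+1.
  rewrite -cf; apply: commr_sym; apply: commr_sum => j _; apply: commrX.
  by rewrite /u; apply: commrB; [exact: commr1|].
apply: (@qunitPl f g); split; apply: eqdeg_eq => N d hd.
  by rewrite (eqdegM (gE N) (fun d _ => erefl (f d))) // cg small.
by rewrite (eqdegM (fun d _ => erefl (f d)) (gE N)) // cf small.
Qed.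

End TorusAlgebra.

(** * Gaussian binomials and the coefficients of the dilogarithm *)

Section QBinomial.
Variables (F : fieldType) (q : F).

(** The Gaussian binomial, given by the q-Pascal rule so that no division occurs. *)
Fixpoint qbin (l j : nat) : F :=
  match l, j with
  | _, 0 => 1
  | 0, _.+1 => 0
  | l'.+1, j'.+1 => qbin l' j' + q ^+ j * qbin l' j
  end.

Definition qfact m := \prod_(j < m) (q ^+ j.+1 - 1).

Lemma qfactS m : qfact m.+1 = qfact m * (q ^+ m.+1 - 1).
Proof. by rewrite /qfact big_ord_recr. Qed.

Lemma qbin0 l : qbin l 0 = 1. Proof. by case: l. Qed.

Lemma qbin_small l j : (l < j)%N -> qbin l j = 0.
Proof.
elim: l j => [|l IH] [|j] //= lj; rewrite !IH ?mulr0 ?addr0 //; exact: ltnW.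
Qed.

Lemma qbin_fact l j : (j <= l)%N -> qbin l j * (qfact j * qfact (l - j)) = qfact l.
Proof.
elim: l j => [|l IH] [|j] jl //; rewrite ?qbin0 ?subn0 ?[qfact 0]big_ord0 ?mul1r //.
rewrite subSS qfactS /=; have h1 := IH j jl.
have [e|ne] := eqVneq j l.
  rewrite e in h1 *; rewrite (@qbin_small l l.+1) // mulr0 addr0 qfactS -{2}h1.
  by rewrite mulrA; ring.
have h2 := IH j.+1 ltac:(lia).
have eS : (l - j = (l - j.+1).+1)%N by lia.
have qS : qfact (l - j) = qfact (l - j.+1) * (q ^+ (l - j) - 1) by rewrite {1}eS qfactS -eS.
have qE : q ^+ l.+1 = q ^+ j.+1 * q ^+ (l - j) by rewrite -exprD; congr (_ ^+ _); lia.
rewrite [RHS]qfactS qE mulrDl.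
transitivity (qfact l * (q ^+ j.+1 - 1) + q ^+ j.+1 * (qfact l * (q ^+ (l - j) - 1))).
  by congr (_ + _); [rewrite -h1; ring|rewrite -h2 !qfactS qS; ring].
by ring.
Qed.

Definition qfall j (x : F) := \prod_(i < j) (x - q ^+ i).

(** Induction on l through x qfall_j(x) = qfall_(j+1)(x) + q^j qfall_j(x). For x = q^m over a field
    with q elements, the j-th term counts the m by l matrices of rank j. *)
Lemma qbinomial l x : x ^+ l = \sum_(j < l.+1) qbin l j * qfall j x.
Proof.
elim: l => [|l IH]; first by rewrite big_ord_recl big_ord0 /qfall big_ord0 /= mulr1 addr0.
have fS j : qfall j.+1 x = qfall j x * (x - q ^+ j) by rewrite /qfall big_ord_recr.
rewrite exprSr IH big_distrl /=.
have -> : \sum_(j < l.+2) qbin l.+1 j * qfall j x =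
   q ^+ 0 * qbin l 0 * qfall 0 x + (\sum_(i < l.+1) qbin l i * qfall i.+1 x +
   \sum_(i < l.+1) q ^+ i.+1 * qbin l i.+1 * qfall i.+1 x).
  rewrite big_ord_recl !qbin0 expr0 !mul1r -big_split; congr (_ + _).
  by apply: eq_bigr => i _; rewrite [RHS]/= -mulrDl.
rewrite addrCA -(big_ord_recl _ (fun i => q ^+ i * qbin l i * qfall i x)).
rewrite [X in _ + X]big_ord_recr /= (@qbin_small l l.+1) // mulr0 mul0r addr0 -big_split.
by apply: eq_bigr => i _ /=; rewrite fS; ring.
Qed.

Lemma qfall_small j m : (m < j)%N -> qfall j (q ^+ m) = 0.
Proof. by move=> mj; rewrite /qfall (bigD1 (Ordinal mj)) //= subrr mul0r. Qed.

Lemma qfall_fact j m : (j <= m)%N ->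
  qfall j (q ^+ m) * qfact (m - j) = q ^+ 'C(j, 2) * qfact m.
Proof.
elim: j => [|j IH] jm; first by rewrite /qfall big_ord0 subn0 bin0n expr0.
have eS : (m - j = (m - j.+1).+1)%N by lia.
rewrite /qfall big_ord_recr /= -/(qfall j (q ^+ m)).
have -> : q ^+ m - q ^+ j = q ^+ j * (q ^+ (m - j) - 1).
  by rewrite mulrBr mulr1 -exprD subnKC // ltnW.
rewrite binS bin1 exprD [RHS]mulrAC -IH ?(ltnW jm) // [in RHS]eS qfactS -eS.
by ring.
Qed.

End QBinomial.

Lemma qpar_qhalf : qpar = qhalf ^+ 2. Proof. by []. Qed.

Lemma qpar_neq0 : qpar != 0.
Proof. by rewrite expf_neq0 ?qhalf_neq0. Qed.

Lemma qparX_neq1 m : qpar ^+ m.+1 - 1 != 0.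
Proof.
rewrite subr_eq0 qpar_qhalf -exprM /qhalf -tofracXn -tofrac1 tofrac_eq.
by apply/eqP => /(congr1 (fun p : {poly rat} => size p)); rewrite size_polyXn size_poly1; lia.
Qed.

Lemma qfact_neq0 m : qfact qpar m != 0.
Proof. by apply/prodf_neq0 => j _; exact: qparX_neq1. Qed.

Lemma qdilog_coefE m : qdilog_coef m = qhalf ^+ m / qfact qpar m.
Proof.
have den : \prod_(j < m) (qpar ^+ m - qpar ^+ j) = qpar ^+ 'C(m, 2) * qfact qpar m.
  by rewrite -(qfall_fact _ (leqnn m)) subnn [qfact _ 0]big_ord0 mulr1.
rewrite /qdilog_coef den invfM mulrA; congr (_ / _).
apply: (canLR (mulfK _)); first by rewrite expf_neq0 ?qpar_neq0.
rewrite qpar_qhalf -exprM -exprD; congr (_ ^+ _).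
by elim: m {den} => [|m IH]; rewrite ?bin0n // binS bin1; nia.
Qed.

(** The pentagon identity at one normally ordered monomial: on the left q^(ml) comes from
    reordering, and [qbinomial] at x = q^m splits it into the terms of the right side, with j the
    exponent of the middle factor. *)
Lemma qexp_pentagon (F : fieldType) (h : F) N l m :
  (forall i, qfact (h ^+ 2) i != 0) -> (l <= N)%N ->
  let c i := h ^+ i / qfact (h ^+ 2) i in
  c m * c l * (h ^+ 2) ^+ (m * l) =
  \sum_(j < N.+1 | (j <= l)%N && (j <= m)%N) c (l - j)%N * c j * c (m - j)%N * h ^+ (j * j).
Proof.
move=> f0 lN c; pose q := h ^+ 2; rewrite exprM (qbinomial q) big_distrr /=.
pose G j := if (j <= l)%N && (j <= m)%N then
   c (l - j)%N * c j * c (m - j)%N * h ^+ (j * j) else 0.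
rewrite [RHS]big_mkcond -[RHS](big_mkord xpredT G).
rewrite (big_cat_nat _ (n := l.+1)) //= [X in _ + X]big_nat [X in _ + X]big1 ?addr0; last first.
  by move=> j jb; rewrite /G; case: ifP => //; lia.
rewrite big_mkord; apply: eq_bigr => -[j jl] _ /=; rewrite ltnS in jl; rewrite /G jl.
case: leqP => [jm|mj] /=; last by rewrite qfall_small // !mulr0.
have h1 := qbin_fact q jl; have h2 := qfall_fact q jm.
have qbE : qbin q l j = qfact q l / (qfact q j * qfact q (l - j)).
  by rewrite -h1 mulfK // mulf_neq0 ?f0.
have qfE : qfall q j (q ^+ m) = q ^+ 'C(j, 2) * qfact q m / qfact q (m - j).
  by rewrite -h2 mulfK // f0.
have hE : h ^+ l * h ^+ m * q ^+ 'C(j, 2) =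
  h ^+ (l - j) * h ^+ j * h ^+ (m - j) * h ^+ (j * j).
  rewrite -exprM -!exprD; congr (_ ^+ _).
  have : (2 * 'C(j, 2) + j = j * j)%N.
    by elim: (j) => [|i IH]; rewrite ?bin0n // binS bin1; nia.
  by lia.
rewrite qbE qfE /c -/q.
transitivity (h ^+ l * h ^+ m * q ^+ 'C(j, 2) /
   (qfact q (l - j) * qfact q j * qfact q (m - j))).
  move: (f0 l) (f0 m) (f0 j) (f0 (l - j)%N) (f0 (m - j)%N); rewrite -/q => *.
  by field; do !(apply/andP; split).
move: (f0 l) (f0 m) (f0 j) (f0 (l - j)%N) (f0 (m - j)%N); rewrite hE -/q => *.
by field; do !(apply/andP; split).
Qed.

Lemma qdilog_coef_pentagon N l m : (l <= N)%N ->
  qdilog_coef m * qdilog_coef l * qpar ^+ (m * l) =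
  \sum_(j < N.+1 | (j <= l)%N && (j <= m)%N)
     qdilog_coef (l - j) * qdilog_coef j * qdilog_coef (m - j) * qhalf ^+ (j * j).
Proof.
move=> lN; rewrite !qdilog_coefE (qexp_pentagon m qfact_neq0 lN).
by apply: eq_bigr => j _; rewrite !qdilog_coefE.
Qed.

Lemma big_shift (V : nmodType) N j (g : nat -> nat -> V) :
  (forall i p, (N < p)%N -> g i p = 0) ->
  \sum_(i < N.+1) g i (i + j)%N = \sum_(l < N.+1 | (j <= l)%N) g (l - j)%N l.
Proof.
move=> g0; rewrite -(big_mkord xpredT (fun i => g i (i + j)%N)).
rewrite -(big_mkord (fun l => (j <= l)%N) (fun l => g (l - j)%N l)).
have [jN|Nj] := leqP j N.+1; last first.
  rewrite big_nat big1 => [|i ib]; last by apply: g0; lia.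
  by rewrite big_nat_cond big1 // => l /andP[]; lia.
rewrite (big_cat_nat _ (n := N.+1 - j)) //=; last lia.
rewrite [X in _ + X]big_nat [X in _ + X]big1 ?addr0; last by move=> i ib; apply: g0; lia.
rewrite [RHS](big_cat_nat _ (n := j)) //= [X in _ = X + _]big_nat_cond.
rewrite [X in _ = X + _]big1 ?add0r; last by move=> i; lia.
have := big_addn 0 N.+1 j (fun l => j <= l)%N (fun l => g (l - j)%N l); rewrite add0n => ->.
rewrite [RHS]big_nat_cond [LHS]big_nat.
apply: eq_big => i; first by rewrite leq_addl andbT.
by move=> _; rewrite addnK.
Qed.

(** The change of indices l = i + j, m = j + k. It does not respect the bound N, but the terms that
    leave the range vanish. *)
Lemma sum_shift (V : nmodType) N (u : nat -> nat -> nat -> nat -> nat -> V) :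
  (forall i j k l m, (N < l)%N || (N < m)%N -> u i j k l m = 0) ->
  \sum_(i < N.+1) \sum_(j < N.+1) \sum_(k < N.+1) u i j k (i + j)%N (j + k)%N =
  \sum_(l < N.+1) \sum_(m < N.+1) \sum_(j < N.+1 | (j <= l)%N && (j <= m)%N)
     u (l - j)%N j (m - j)%N l m.
Proof.
move=> u0; rewrite exchange_big /=.
transitivity (\sum_(j < N.+1) \sum_(l < N.+1 | (j <= l)%N)
    \sum_(m < N.+1 | (j <= m)%N) u (l - j)%N j (m - j)%N l m).
  apply: eq_bigr => j _.
  rewrite (big_shift _ (g := fun i l => \sum_(k < N.+1) u i j k l (j + k)%N)); last first.
    by move=> i p Np; rewrite big1 // => k _; rewrite u0 // Np.
  apply: eq_bigr => l _; under eq_bigr do rewrite addnC.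
  by apply: (big_shift _ (g := fun i m => u (l - j)%N j i l m)) => i p Np;
     rewrite u0 // Np orbT.
rewrite (exchange_big_dep xpredT) //=; apply: eq_bigr => l _.
rewrite (exchange_big_dep xpredT) //=.
Qed.

(** * The pentagon identity for quantum dilogarithms *)

Section Pentagon.
Variables (k : finFieldType) (n : nat).
Implicit Types (a b d e : dimvec n).
Local Notation y := (@ymon k n).

Lemma ymonME a b : y a * y b = qhalf ^ lam k a b *: y (a + b).
Proof. by rewrite ymonM. Qed.

Lemma ymon00 a : a != 0 -> y a 0 = 0.
Proof. by move=> a0; rewrite /ymon eq_sym (negPf a0). Qed.

Definition qtrunc N a : qtorus k n := \sum_(m < N.+1) qdilog_coef m *: y a ^+ m.

Lemma qdilog_trunc N a : a != 0 -> eqdeg N (qdilog k a) (qtrunc N a).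
Proof.
move=> a0 d dN; rewrite /qdilog /qtrunc qsumE -/(deg d).
rewrite -(big_mkord xpredT (fun m => qdilog_coef m * (y a ^+ m) d)).
rewrite -(big_mkord xpredT (fun m => (qdilog_coef m *: y a ^+ m) d)).
rewrite [RHS](big_cat_nat _ (n := (deg d).+1)) //= [X in _ + X]big_nat.
rewrite [X in _ + X]big1 ?addr0 // => j /andP[hj _].
by rewrite qtorusZ low_degX ?mulr0 // ymon00.
Qed.

Lemma qdilog_unit a : qdilog k a \is a GRing.unit.
Proof.
apply: qunit_const1; rewrite /qdilog.
have -> : (\sum_i (0%R : dimvec n) i = 0)%N by apply/eqP; rewrite -/(deg _) deg_eq0.
rewrite big_ord_recl big_ord0 addr0 expr0 qtorus10 mulr1.
by rewrite qdilog_coefE expr0 /qfact big_ord0 divr1.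
Qed.

Lemma lam_antisym a b : lam k a b = - lam k b a.
Proof. by rewrite /lam [RHS]opprB. Qed.

Lemma qdilog_comm a b : a != 0 -> b != 0 -> lam k a b = 0 ->
  GRing.comm (qdilog k a) (qdilog k b).
Proof.
move=> a0 b0 ab; apply: eqdeg_eq => N d dN.
rewrite (eqdegM (@qdilog_trunc N _ a0) (@qdilog_trunc N _ b0)) //.
rewrite (eqdegM (@qdilog_trunc N _ b0) (@qdilog_trunc N _ a0)) //; congr (_ d).
suff : GRing.comm (qtrunc N a) (qtrunc N b) by [].
have c : GRing.comm (y a) (y b).
  by rewrite /GRing.comm !ymonME (lam_antisym b) ab addrC.
rewrite /qtrunc; apply: commr_sum => i _; apply: commr_sym; apply: commr_sum => j _.
apply: commr_sym; rewrite /GRing.comm -!scalerAl -!scalerAr scalerA mulrC -scalerA.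
by congr (_ *: (_ *: _)); apply/commrX/commr_sym/commrX/commr_sym.
Qed.

(** For A = y^a, B = y^b and C = y^(a+b) the hypothesis gives A B = q B A and C = q^(1/2) B A. Both
    sides are expanded in the normally ordered monomials B^l A^m, up to degree N, and compared
    coefficientwise. *)
Lemma qdilog_pentagon a b : a != 0 -> b != 0 -> lam k a b = 1 ->
  qdilog k a * qdilog k b = qdilog k b * qdilog k (a + b) * qdilog k a.
Proof.
move=> a0 b0 ab.
have ab0 : a + b != 0.
  by rewrite -deg_eq0 degD addn_eq0 !deg_eq0 negb_and a0.
apply: eqdeg_eq => N d dN.
have tr := @qdilog_trunc N.
rewrite (eqdegM (tr _ a0) (tr _ b0)) //.
rewrite (eqdegM (eqdegM (tr _ b0) (tr _ ab0)) (tr _ a0)) //.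
set A := y a; set B := y b; set C := y (a + b).
have hC : C = qhalf *: (B * A).
  rewrite /B /A ymonME (lam_antisym b) ab scalerA exprN1 divff ?scale1r ?qhalf_neq0 //.
  by rewrite addrC.
have AB : A * B = qpar *: (B * A).
  by rewrite /A ymonME ab expr1z -/C hC scalerA qpar_qhalf expr2.
have ABm m : A * B ^+ m = qpar ^+ m *: (B ^+ m * A).
  elim: m => [|m IH]; first by rewrite !expr0 mulr1 mul1r scale1r.
  by rewrite (exprS B) mulrA AB -scalerAl -(mulrA B A) IH -scalerAr scalerA -(exprS qpar) mulrA.
have AmBl m l : A ^+ m * B ^+ l = qpar ^+ (m * l) *: (B ^+ l * A ^+ m).
  elim: m => [|m IH]; first by rewrite mul0n expr0 mul1r mulr1 scale1r.
  by rewrite (exprSr A) -mulrA ABm -scalerAr (mulrA (A ^+ m) (B ^+ l)) IH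
    -scalerAl scalerA -exprD -mulrA mulSn.
have Cj j : C ^+ j = qhalf ^+ (j * j) *: (B ^+ j * A ^+ j).
  elim: j => [|j IH]; first by rewrite !expr0 mulr1 scale1r.
  rewrite exprSr IH {1}hC -scalerAl -scalerAr scalerA -[B ^+ j * A ^+ j * (B * A)]mulrA.
  rewrite (mulrA (A ^+ j)) -(expr1 B) (AmBl j 1%N) -scalerAl -scalerAr scalerA expr1.
  rewrite !mulrA -exprSr -!mulrA -exprSr; congr (_ *: _); last by rewrite mulrA -exprSr.
  by rewrite qpar_qhalf -exprM -exprD; congr (_ ^+ _); lia.
pose t l m : Kq := (B ^+ l * A ^+ m) d.
have t0 l m : (N < l)%N || (N < m)%N -> t l m = 0.
  move=> lm; apply: (@low_degM k n l m).
  - by apply: low_degX; exact: ymon00.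
  - by apply: low_degX; exact: ymon00.
  - by lia.
have lhs : (qtrunc N a * qtrunc N b) d = \sum_(l < N.+1) \sum_(m < N.+1)
    qdilog_coef m * qdilog_coef l * qpar ^+ (m * l) * t l m.
  rewrite /qtrunc big_distrl qsumE [RHS]exchange_big /=; apply: eq_bigr => m _.
  rewrite big_distrr qsumE; apply: eq_bigr => l _.
  by rewrite [LHS]/= -scalerAl -scalerAr AmBl !scalerA qtorusZ.
have rhs : (qtrunc N b * qtrunc N (a + b) * qtrunc N a) d =
    \sum_(i < N.+1) \sum_(j < N.+1) \sum_(m < N.+1)
    qdilog_coef i * qdilog_coef j * qdilog_coef m * qhalf ^+ (j * j) * t (i + j)%N (j + m)%N.
  rewrite /qtrunc -mulrA big_distrl qsumE; apply: eq_bigr => i _.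
  rewrite big_distrl big_distrr qsumE; apply: eq_bigr => j _.
  rewrite big_distrr big_distrr qsumE; apply: eq_bigr => m _; rewrite [LHS]/=.
  rewrite -/A -/B -/C Cj /t exprD [A ^+ (j + m)]exprD.
  move: (qdilog_coef i) (qdilog_coef j) (qdilog_coef m) (qhalf ^+ _) => ci cj cm hj.
  do ![rewrite -scalerAl|rewrite -scalerAr|rewrite scalerA].
  have -> : B ^+ i * (B ^+ j * A ^+ j * A ^+ m) = B ^+ i * B ^+ j * (A ^+ j * A ^+ m).
    by rewrite !mulrA.
  by rewrite qtorusZ -[ci * cj * cm * hj]mulrA (mulrC cm) -!(mulrA ci) (mulrA cj).
rewrite lhs rhs.
rewrite (@sum_shift _ N (fun i j m l' m' => qdilog_coef i * qdilog_coef j * qdilog_coef m *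
   qhalf ^+ (j * j) * t l' m')); last by move=> i j m l' m' /t0 ->; rewrite mulr0.
apply: eq_bigr => l _; apply: eq_bigr => m _.
by rewrite (@qdilog_coef_pentagon N) ?big_distrl // -ltnS.
Qed.

End Pentagon.

(** * Arcs of the cyclic quiver *)

Section Vertices.
Variable n : nat.
Implicit Type s : 'I_n.

Definition vtx s t := iter t (@ordS n) s.

Lemma vtxE s t : vtx s t = ((s + t) %% n)%N :> nat.
Proof.
elim: t => [|t IH]; first by rewrite addn0 modn_small.
by rewrite /vtx iterS /= -/(vtx s t) IH -[in RHS]addn1 addnA -(modnDml (s + t)) addn1.
Qed.

Lemma vtxS s t : vtx (ordS s) t = vtx s t.+1.
Proof. by rewrite /vtx -iterSr. Qed.

Lemma ord_gt0 s : (0 < n)%N. Proof. exact: leq_ltn_trans (ltn_ord s). Qed.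

Lemma vtxDn s t : vtx s (t + n) = vtx s t.
Proof. by apply: ord_inj; rewrite !vtxE addnA modnDr. Qed.

Lemma ord_pred_vtx s t : ord_pred (vtx s t) = vtx s (t + n.-1).
Proof.
apply: (can_inj (@ordSK n)); rewrite ord_predK -[RHS]/(vtx s (t + n.-1).+1).
by rewrite -addnS prednK ?(ord_gt0 s) // vtxDn.
Qed.

Lemma vtx_eq s t u : (vtx s t == vtx s u) = (t == u %[mod n]).
Proof. by rewrite -val_eqE /= !vtxE eqn_modDl. Qed.

Lemma vtx_neq s t u : (t < u < t + n)%N -> vtx s t != vtx s u.
Proof.
move=> tu; rewrite vtx_eq eq_sym eqn_mod_dvd; last lia.
by apply/negP => /dvdn_leq; lia.
Qed.

Lemma vtx_surj s v : exists2 t, (t < n)%N & v = vtx s t.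
Proof.
exists ((v + (n - s)) %% n)%N; first by rewrite ltn_mod (ord_gt0 s).
apply: ord_inj; rewrite vtxE modnDmr addnCA subnKC ?(ltnW (ltn_ord s)) //.
by rewrite modnDr modn_small.
Qed.

Definition arc_dim s c d : dimvec n := \sum_(c <= t < d) dim_simple (vtx s t).

Lemma arcE s c d v : arc_dim s c d v = (\sum_(c <= t < d) (v == vtx s t))%N.
Proof.
by rewrite /arc_dim; elim/big_rec2: _ => [|t x y _ <-]; rewrite !ffunE.
Qed.

Lemma arcD s c x d : (c <= x <= d)%N -> arc_dim s c x + arc_dim s x d = arc_dim s c d.
Proof. by move=> /andP[cx xd]; rewrite /arc_dim -big_cat_nat. Qed.

Lemma arc_dim_ordS s c d : arc_dim (ordS s) c d = arc_dim s c.+1 d.+1.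
Proof.
rewrite /arc_dim big_add1 /=; apply: eq_bigr => t _.
by rewrite vtxS.
Qed.

Lemma arcDn s c d : arc_dim s (c + n) (d + n) = arc_dim s c d.
Proof.
rewrite /arc_dim (addnC c) (addnC d) -[(n + c)%N]addnC big_addn (addnC n d) addnK.
by apply: eq_bigr => t _; rewrite vtxDn.
Qed.

Lemma arc_in s c d t : (c <= t < d)%N -> (d <= c + n)%N -> arc_dim s c d (vtx s t) = 1%N.
Proof.
move=> tcd dn; rewrite arcE (bigD1_seq t) ?mem_index_iota ?iota_uniq //= eqxx.
rewrite big_seq_cond big1 // => u; rewrite mem_index_iota => /andP[ub tu].
apply/eqP; rewrite eqb0; have [lt|lt|e] := ltngtP t u.
- by apply: vtx_neq; lia.
- by rewrite eq_sym; apply: vtx_neq; lia.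
- by rewrite e eqxx in tu.
Qed.

Lemma arc_out s c d t : (d <= t < c + n)%N -> arc_dim s c d (vtx s t) = 0%N.
Proof.
move=> tcd; rewrite arcE big_nat big1 // => u ub.
by apply/eqP; rewrite eqb0 eq_sym; apply: vtx_neq; lia.
Qed.

Lemma arc_neq0 s c d : (c < d)%N -> arc_dim s c d != 0.
Proof.
move=> cd; apply/eqP => /ffunP/(_ (vtx s c)); rewrite arcE ffunE.
by rewrite (bigD1_seq c) ?mem_index_iota ?iota_uniq ?leqnn //= eqxx.
Qed.

Lemma arc_full s : arc_dim s 0 n = delta n.
Proof.
apply/ffunP => v; have [t tn ->] := vtx_surj s v.
by rewrite arc_in ?ffunE.
Qed.

End Vertices.

(** * The form lambda on arcs, and independence of the starting vertex *)

Section Twist.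
Variables (k : finFieldType) (n : nat).
Implicit Types (a b : dimvec n) (s : 'I_n).

Lemma lamE a b : lam k a b = \sum_i ((a i)%:Z * (b (ordS i))%:Z - (a (ordS i))%:Z * (b i)%:Z).
Proof.
rewrite /lam !chiE -sumrB; apply: eq_bigr => i _.
by rewrite opprB addrC (mulrC (b i)%:Z) addrA subrK (mulrC (a i)%:Z).
Qed.

Lemma lam_simple j b : lam k (dim_simple j) b = (b (ordS j))%:Z - (b (ord_pred j))%:Z.
Proof.
rewrite lamE sumrB; congr (_ - _).
  rewrite (bigD1 j) //= ffunE eqxx mul1r big1 ?addr0 // => i /negPf ij.
  by rewrite ffunE ij mul0r.
rewrite (bigD1 (ord_pred j)) //= ffunE ord_predK eqxx mul1r big1 ?addr0 // => i ij.
rewrite ffunE; case: eqP => [e|]; last by rewrite mul0r.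
by rewrite -e ordSK eqxx in ij.
Qed.

(** A telescoping sum: the simple at t pairs with b to b(t+1) - b(t-1), so only the two ends of the
    arc contribute. The offset n.-1 encodes a step back, without subtraction. *)
Lemma lam_arc s c d b : (c <= d)%N -> lam k (arc_dim s c d) b =
  (b (vtx s d))%:Z + (b (vtx s (d + n.-1)))%:Z
  - (b (vtx s c))%:Z - (b (vtx s (c + n.-1)))%:Z.
Proof.
move=> /subnK <-; move: (d - c)%N => l; elim: l => [|l IH].
  by rewrite /arc_dim add0n big_geq // lam0l -addrA -opprD subrr.
have -> : arc_dim s c (l.+1 + c) = arc_dim s c (l + c) + dim_simple (vtx s (l + c)).
  by rewrite /arc_dim addSn big_nat_recr ?leq_addl.
have e : vtx s (l.+1 + c + n.-1) = vtx s (l + c).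
  by rewrite -(vtxDn s (l + c)); congr vtx; have := ord_gt0 s; lia.
rewrite lamDl IH lam_simple ord_pred_vtx e -[ordS _]/(vtx s (l.+1 + c)).
lia.
Qed.

Definition Earc s c d := qdilog k (arc_dim s c d).

Lemma Earc_unit s c d : Earc s c d \is a GRing.unit.
Proof. exact: qdilog_unit. Qed.

Lemma Earc_pentagon s c x d : (c < x < d)%N -> (d < c + n)%N ->
  Earc s c x * Earc s x d = Earc s x d * Earc s c d * Earc s c x.
Proof.
move=> xb dn; rewrite /Earc qdilog_pentagon ?arc_neq0 ?arcD //; try lia.
rewrite lam_arc; last lia.
(* Of the four terms only the one at x survives; the one at c-1, that is c + n - 1, vanishes because
   d < c + n. *)
rewrite (arc_in s (t := x)) ?(arc_out s (t := x + n.-1)) //; try lia.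
by rewrite -(vtxDn s c) !arc_out; lia.
Qed.

Lemma Earc_comm s c d b : (c < d)%N -> b != 0 ->
  (b (vtx s d) + b (vtx s (d + n.-1)) = b (vtx s c) + b (vtx s (c + n.-1)))%N ->
  GRing.comm (Earc s c d) (qdilog k b).
Proof.
move=> cd b0 e; apply: qdilog_comm; rewrite ?arc_neq0 ?lam_arc //; try lia.
Qed.

Lemma Earc_disjoint s c d c' d' : (c < d)%N -> (d < c' < d')%N -> (d' < c + n)%N ->
  Earc s c d * Earc s c' d' = Earc s c' d' * Earc s c d.
Proof.
move=> cd dc d'n; apply: Earc_comm; rewrite ?arc_neq0 //; first lia.
by rewrite -(vtxDn s d) -(vtxDn s c) !arc_out //; lia.
Qed.

Lemma Earc_nested s c d c' d' : (c < c')%N -> (c' < d' < d)%N -> (d < c + n)%N ->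
  Earc s c' d' * Earc s c d = Earc s c d * Earc s c' d'.
Proof.
move=> cc c'd' dn; apply: Earc_comm; rewrite ?arc_neq0 //; try lia.
have sh t : (0 < t)%N -> vtx s (t + n.-1) = vtx s t.-1.
  move=> t0; rewrite -(vtxDn s t.-1); congr vtx.
  by have := ord_gt0 s; lia.
by rewrite !sh ?arc_in //; lia.
Qed.

(** The arcs are complementary: their classes add up to delta, which pairs to zero with everything,
    so their contributions at the two common ends cancel. *)
Lemma Earc_suffix_comm s : (1 < n)%N -> GRing.comm (Earc s 0 1) (Earc s 1 n).
Proof.
move=> n1; apply: Earc_comm; rewrite ?arc_neq0 //.
rewrite (arc_in s (t := 1)) ?(arc_in s (t := 0 + n.-1)) //; try lia.
by rewrite -(vtxDn s 0) !arc_out //; lia.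
Qed.

Definition Ecyc s := simple_prod (Earc s) 1 n * (simple_prod (Earc s) 1 n.-1)^-1
  * simple_prod (Earc s) 0 n.-1.

Lemma simple_prod_rot s p q :
  simple_prod (Earc (ordS s)) p q = simple_prod (Earc s) p.+1 q.+1.
Proof.
rewrite /simple_prod big_add1 /=; apply: eq_bigr => t _.
by rewrite /Earc arc_dim_ordS.
Qed.

Lemma Ecyc_rot s : (1 < n)%N -> Ecyc (ordS s) = Ecyc s.
Proof.
move=> n1; rewrite /Ecyc (simple_prod_rot s 1 n) (simple_prod_rot s 1 n.-1).
rewrite (simple_prod_rot s 0 n.-1).
have -> : simple_prod (Earc s) 2 n.+1 = simple_prod (Earc s) 2 n * Earc s 0 1.
  rewrite /simple_prod big_nat_recr //=.
  by rewrite /Earc -[in RHS]arcDn add0n add1n.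
rewrite prednK ?(ord_gt0 s) //.
have [n2|n2] := ltnP 2 n.
  rewrite (rotation (ord_gt0 s) (@Earc_unit s) (@Earc_pentagon s) (@Earc_disjoint s)) //.
  - by move=> t tb; apply: Earc_disjoint; lia.
  - exact: Earc_suffix_comm.
(* For n = 2 the claim is E_0 E_1 = E_1 E_0: the two simples are complementary arcs. *)
have s2n : simple_prod (Earc s) 2 n = 1 by rewrite /simple_prod big_geq.
have s11 : simple_prod (Earc s) 1 n.-1 = 1 by rewrite /simple_prod big_geq //; lia.
have s1n : simple_prod (Earc s) 1 n = Earc s 1 n.
  rewrite /simple_prod big_ltn // big_geq ?mulr1 //.
  by congr (Earc s _ _); lia.
have s01 : simple_prod (Earc s) 0 n.-1 = Earc s 0 1.
  by rewrite /simple_prod big_ltn ?big_geq ?mulr1 //; lia.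
by rewrite s2n s11 s1n s01 invr1 mul1r !mulr1; exact: Earc_suffix_comm.
Qed.

Lemma tau_qdilog a : tau (qdilog k a) = qdilog k (tau_dim a).
Proof.
apply/funext => e; rewrite -[LHS]/(qdilog k a (tau_dimV e)) /qdilog.
have -> : (\sum_i tau_dimV e i = \sum_i e i)%N.
  rewrite (reindex_inj (@ordS_inj n)) /=.
  by apply: eq_bigr => i _; rewrite ffunE ordSK.
apply: eq_bigr => m _; rewrite -(tau_ymon k a) -rmorphXn.
by [].
Qed.

Lemma tau_arc s c d : tau_dim (arc_dim (ordS s) c d) = arc_dim s c d.
Proof.
apply/ffunP => v; rewrite ffunE !arcE; apply: eq_bigr => t _.
by rewrite /vtx -iterSr iterS (inj_eq (@ordS_inj n)).
Qed.

Lemma tau_Ecyc s : tau (Ecyc (ordS s)) = Ecyc s.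
Proof.
have tau_simple_prod p q : tau (simple_prod (Earc (ordS s)) p q) = simple_prod (Earc s) p q.
  rewrite /simple_prod rmorph_prod; apply: eq_bigr => t _.
  by rewrite [LHS]tau_qdilog tau_arc.
rewrite /Ecyc !rmorphM rmorphV; last exact: (simple_prod_unit (@Earc_unit (ordS s))).
by rewrite -!(tau_simple_prod).
Qed.

Lemma tau_Ecyc_invariant s : (1 < n)%N -> tau (Ecyc s) = Ecyc s.
Proof. by move=> n1; rewrite -{1}Ecyc_rot // tau_Ecyc. Qed.

End Twist.

(** * Stable representations *)

Section Subrep.
Variables (k : fieldType) (n : nat) (X : nilrep k n).
Variables (m : 'I_n -> nat) (W : forall i, 'M[k]_(m i, rdim X i)).
Hypothesis W_stable : forall i, (W (ordS i) *m rmap X i <= W i)%MS.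

Let V i := row_base (W i).

(** The rows of [W i] need only span the subspace; passing to [row_base] allows kernels and images
    as they come. *)
Definition sub_rep : rep k n :=
  @Rep k n (fun i => \rank (W i)) (fun i => V (ordS i) *m rmap X i *m pinvmx (V i)).

Lemma sub_incl_hom : @is_hom _ _ sub_rep X V.
Proof.
move=> i; rewrite /= mulmxKpV // /V (eqmxMr _ (eq_row_base _)).
by rewrite eq_row_base W_stable.
Qed.

Lemma sub_rep_nilpotent : nilpotent sub_rep.
Proof.
have [M hM] := nrepP X; exists M => i.
apply: (row_free_inj (row_base_free (W i))); rewrite mul0mx.
suff /(_ M) -> : forall M', path_mx sub_rep i M' *m V i = V _ *m path_mx X i M'.
  by rewrite hM mulmx0.
elim=> [|M' IH]; first by rewrite mul1mx mulmx1.
rewrite -[path_mx sub_rep i M'.+1]/(rmap sub_rep _ *m path_mx sub_rep i M').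
by rewrite -mulmxA IH mulmxA sub_incl_hom -mulmxA.
Qed.

Lemma subrepP : exists Y : nilrep k n, exists f : mxfam Y X,
  [/\ is_hom f, is_mono f & forall i, rdim Y i = \rank (W i)].
Proof.
exists (NilRep sub_rep_nilpotent), V; split=> //; first exact: sub_incl_hom.
by move=> i; exact: row_base_free.
Qed.

End Subrep.

Lemma iso_rdim (k : fieldType) n (X Y : nilrep k n) (f : mxfam X Y) :
  is_iso f -> forall i, rdim X i = rdim Y i.
Proof.
case=> g [_ fg gf] i; apply/eqP; rewrite eqn_leq.
have := mulmx1_min (fg i); have := mulmx1_min (gf i) => -> ->; by [].
Qed.

Section Paths.
Variables (k : fieldType) (n : nat) (X : rep k n).
Implicit Types (i j w : 'I_n) (m t : nat).

(* The total matrix of the paths of length m from X_j to X_i: zero unless     *)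
(* j = i + m, and defined for all i and j to avoid casts.                     *)
Fixpoint pmx m i j : 'M[k]_(rdim X j, rdim X i) :=
  if m is m'.+1 then pmx m' (ordS i) j *m rmap X i
  else if i == j then pid_mx (rdim X i) else 0.

Lemma pmx_neq m i j : j != vtx i m -> pmx m i j = 0.
Proof.
elim: m i => [|m IH] i /= ij; first by rewrite eq_sym (negPf ij).
by rewrite IH ?mul0mx // vtxS.
Qed.

Lemma pmx0 i : pmx 0 i i = 1%:M.
Proof. by rewrite /= eqxx pid_mx_1. Qed.

Lemma pmxS m i j : pmx m.+1 i (ordS j) = rmap X j *m pmx m i j.
Proof.
elim: m i j => [|m IH] i j.
  rewrite /= (inj_eq (@ordS_inj n)); case: eqP => [->|_]; last by rewrite mul0mx mulmx0.
  by rewrite !pid_mx_1 mul1mx mulmx1.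
by rewrite [LHS]/= -/(pmx m.+1 (ordS i) (ordS j)) IH mulmxA.
Qed.

Lemma pmx_path m i : pmx m i (vtx i m) = path_mx X i m.
Proof. by elim: m => [|m IH]; [exact: pmx0|rewrite pmxS IH]. Qed.

Lemma pmxD m m' i j : pmx m (vtx i m') j *m pmx m' i (vtx i m') = pmx (m + m') i j.
Proof.
elim: m' i => [|m' IH] i; first by rewrite pmx0 mulmx1 addn0.
rewrite addnS -vtxS -[pmx m'.+1 i _]/(pmx m' (ordS i) _ *m rmap X i).
by rewrite mulmxA IH.
Qed.

End Paths.

Section Dist.
Variable n : nat.
Implicit Types i w : 'I_n.

Definition dist i w : nat := ((w + (n - i)) %% n)%N.

Lemma dist_lt i w : (dist i w < n)%N.
Proof. by rewrite ltn_mod (ord_gt0 i). Qed.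

Lemma vtx_dist i w : vtx i (dist i w) = w.
Proof.
apply: ord_inj; rewrite vtxE modnDmr addnCA subnKC ?(ltnW (ltn_ord i)) //.
by rewrite modnDr modn_small.
Qed.

Lemma dist_vtx i t : (t < n)%N -> dist i (vtx i t) = t.
Proof.
move=> tn; apply/eqP; rewrite -(modn_small (dist_lt _ _)) -[X in _ == X](modn_small tn).
by rewrite -(vtx_eq i) vtx_dist.
Qed.

Lemma dist0 i : dist i i = 0%N.
Proof. by rewrite -[in LHS](erefl : vtx i 0 = i) dist_vtx ?(ord_gt0 i). Qed.

Lemma dist_ordS i w : ordS w != i -> dist i (ordS w) = (dist i w).+1.
Proof.
move=> wi; have lt := dist_lt i w.
have [e|ne] := eqVneq (dist i w).+1 n; last first.
  by rewrite -{1}(vtx_dist i w) -[ordS _]/(vtx i (dist i w).+1) dist_vtx //; lia.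
case/eqP: wi; rewrite -{1}(vtx_dist i w) -[LHS]/(vtx i (dist i w).+1) e.
exact: (vtxDn i 0).
Qed.

Lemma dist_pred i w : ordS w = i -> (dist i w).+1 = n.
Proof.
move=> e; apply/eqP; rewrite eqn_leq dist_lt /= leqNgt; apply/negP => lt.
have : dist i (vtx i (dist i w).+1) = (dist i w).+1 by rewrite dist_vtx.
by rewrite -[vtx i _]/(ordS (vtx i (dist i w))) vtx_dist e dist0.
Qed.

End Dist.

(** * Comparison of phases by cross products *)

Section Cross.
Variable R : realType.
Implicit Types z w : R[i].

(** It equals the product of the moduli times the sine of [carg w - carg z]. On arguments in [0, pi)
    its sign compares phases, and it is bilinear. *)
Definition cross z w : R := complex.Re z * complex.Im w - complex.Im z * complex.Re w.

Lemma crossDl z z' w : cross (z + z') w = cross z w + cross z' w.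
Proof. by case: z z' w => [a b] [a' b'] [c d]; rewrite /cross /=; lra. Qed.

Lemma crossDr z w w' : cross z (w + w') = cross z w + cross z w'.
Proof. by case: z w w' => [a b] [a' b'] [c d]; rewrite /cross /=; lra. Qed.

Lemma crosszz z : cross z z = 0.
Proof. by rewrite /cross mulrC subrr. Qed.

Definition upper z : Prop := z != 0 /\ 0 <= carg z < pi.

Lemma cabs_gt0 z : z != 0 -> 0 < cabs z.
Proof.
move=> z0; have [e _] := cargP z0; rewrite lt0r sqrtr_ge0 andbT.
by apply: contra_neq z0 => c0; rewrite e c0 !mul0r.
Qed.

Lemma carg_lt z w : upper z -> upper w -> (carg z < carg w) = (0 < cross z w).
Proof.
move=> [z0 zb] [w0 wb]; have [ez _] := cargP z0; have [ew _] := cargP w0.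
have cz := cabs_gt0 z0; have cw := cabs_gt0 w0.
set a := carg z in ez zb *; set b := carg w in ew wb *.
have -> : cross z w = cabs z * cabs w * sin (b - a).
  by rewrite /cross {1 2}ez {1 2}ew /= sinB; lra.
rewrite pmulr_rgt0 ?mulr_gt0 //.
have sin_pos (x y : R) : 0 <= x -> y < pi -> x < y -> 0 < sin (y - x).
  by move=> x0 ypi xy; apply: sin_gt0_pi; rewrite subr_gt0 xy ltrBlDr ltr_wpDr.
case/andP: zb => a0 api; case/andP: wb => b0 bpi.
have [ab|ba|->] := ltgtP a b; first by rewrite sin_pos.
  by have := sin_pos _ _ b0 api ba; rewrite -[a - b]opprB sinN; lra.
by rewrite subrr sin0 ltxx.
Qed.

Lemma carg_eq z w : upper z -> upper w -> (carg z == carg w) = (cross z w == 0).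
Proof.
move=> uz uw; have h1 := carg_lt uz uw; have h2 := carg_lt uw uz.
have e : cross w z = - cross z w by rewrite /cross; lra.
rewrite e in h2; rewrite eq_le !leNgt h1 h2 oppr_gt0 -!leNgt.
by rewrite -eq_le eq_sym.
Qed.

(** The numbers cross(z, z+w), cross(z, w) and cross(z+w, w) coincide, so all these comparisons have
    the same outcome. *)
Lemma carg_seesaw z w : upper z -> upper w -> upper (z + w) ->
  [/\ carg z < carg w -> carg z < carg (z + w) < carg w,
      carg w < carg z -> carg w < carg (z + w) < carg z
    & carg z = carg w -> carg (z + w) = carg z].
Proof.
move=> uz uw uzw; rewrite !carg_lt //.
have e : cross w z = - cross z w by rewrite /cross; lra.
rewrite !(crossDl, crossDr) !crosszz !(addr0, add0r).
split=> [-> //|-> //|/eqP].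
by rewrite carg_eq // => /eqP h; apply/eqP; rewrite carg_eq // crossDl crosszz add0r e h oppr0.
Qed.

End Cross.

Section Stability.
Variables (R : realType) (k : finFieldType) (n : nat) (Z : {additive G0 n -> R[i]}).
Hypothesis Z_stab : stability_function k Z.
Implicit Types (X Y : nilrep k n) (d e : dimvec n) (i j w : 'I_n).

Definition toG d : G0 n := [ffun i => (d i)%:Z].

Lemma toGD d e : toG (d + e) = toG d + toG e.
Proof. by apply/ffunP => i; rewrite !ffunE PoszD. Qed.

Lemma class_toG X : class_G0 X = toG (dim_of X).
Proof. by apply/ffunP => i; rewrite !ffunE. Qed.

Definition Zdim d : R[i] := Z (toG d).

Lemma ZdimD d e : Zdim (d + e) = Zdim d + Zdim e.
Proof. by rewrite /Zdim toGD raddfD. Qed.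

Lemma phase_dim X : phase Z X = carg (Zdim (dim_of X)).
Proof. by rewrite /phase class_toG. Qed.

Lemma dim_of_ss d : dim_of (ss k d) = d.
Proof. by apply/ffunP => i; rewrite ffunE. Qed.

Lemma is_zero_dim X : is_zero X <-> dim_of X = 0.
Proof.
split=> [h|/ffunP h i]; first by apply/ffunP => i; rewrite !ffunE h.
by have := h i; rewrite !ffunE.
Qed.

Lemma upper_Zdim d : d != 0 -> upper (Zdim d).
Proof.
move=> d0; have nz : ~ is_zero (ss k d).
  by move/is_zero_dim; rewrite dim_of_ss; exact/eqP.
have [z0 zb] := Z_stab nz; move: z0 zb.
by rewrite phase_dim class_toG dim_of_ss.
Qed.

Lemma upper_class X : ~ is_zero X -> upper (Zdim (dim_of X)).
Proof. by move=> nz; apply: upper_Zdim; apply/eqP => /is_zero_dim. Qed.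

(** If both were nonzero, cross(Y1, X) and cross(Y2, X) would be positive, although they add up to
    cross(X, X) = 0. Using two subobjects avoids the construction of quotients. *)
Lemma stable_not_split X Y1 Y2 (f1 : mxfam Y1 X) (f2 : mxfam Y2 X) :
  stable Z X -> is_hom f1 -> is_mono f1 -> is_hom f2 -> is_mono f2 ->
  (forall i, rdim X i = (rdim Y1 i + rdim Y2 i)%N) -> is_zero Y1 \/ is_zero Y2.
Proof.
move=> [Xnz Xst] h1 m1 h2 m2 dX; apply: contrapT => /not_orP[nz1 nz2].
have ni1 : ~ is_iso f1.
  by move/iso_rdim => e; apply: nz2 => i; have := dX i; rewrite e; lia.
have ni2 : ~ is_iso f2.
  by move/iso_rdim => e; apply: nz1 => i; have := dX i; rewrite e; lia.
have p1 := Xst _ _ h1 m1 ni1 nz1; have p2 := Xst _ _ h2 m2 ni2 nz2.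
have eX : dim_of X = dim_of Y1 + dim_of Y2.
  by apply/ffunP => i; rewrite !ffunE dX.
have u1 := upper_class nz1; have u2 := upper_class nz2; have uX := upper_class Xnz.
move: p1 p2; rewrite !phase_dim !carg_lt //.
have := crosszz (Zdim (dim_of X)); rewrite {1}eX ZdimD crossDl.
by move: (cross _ _) (cross _ _) => x y; lra.
Qed.

(** Kernel and image are both subobjects of X, and their dimensions add up to those of X. *)
Lemma schur X (f : mxfam X X) : stable Z X -> is_hom f ->
  is_mono f \/ forall i, f i = 0.
Proof.
move=> st hf.
have [|Y1 [f1 [hf1 mf1 d1]]] := @subrepP k n X _ (fun i => kermx (f i)).
  by move=> i; apply/sub_kermxP; rewrite -mulmxA hf mulmxA mulmx_ker mul0mx.
have [|Y2 [f2 [hf2 mf2 d2]]] := @subrepP k n X _ f.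
  by move=> i; rewrite -hf submxMl.
have [|z|z] := stable_not_split st hf1 mf1 hf2 mf2.
- by move=> i; rewrite d1 d2 mxrank_ker subnK // rank_leq_row.
- left=> i; rewrite /row_free eqn_leq rank_leq_row -subn_eq0 -mxrank_ker -d1 z.
  exact: eqxx.
by right=> i; apply/eqP; rewrite -mxrank_eq0 -d2 z.
Qed.

End Stability.

Section Nilpotent.
Variables (k : fieldType) (n : nat) (X : nilrep k n).
Local Notation pm := (pmx X).

Lemma pmx_eq0_leq m m' : (m <= m')%N -> (forall i j, pm m i j = 0) ->
  forall i j, pm m' i j = 0.
Proof.
move=> /subnK <- h; elim: (m' - m)%N => [|t IH] i j //.
by rewrite addSn /= IH mul0mx.
Qed.

Lemma longest_path : ~ is_zero X -> exists m i j,
  [/\ j = vtx i m, pm m i j != 0 & forall i j, pm m.+1 i j = 0].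
Proof.
move=> nz; have [M0 hM0] := nrepP X.
pose P M := `[< forall i j, pm M i j = 0 >].
have ex : exists M, P M.
  exists M0; apply/asboolP => i j; have [->|/pmx_neq ->//] := eqVneq j (vtx i M0).
  by rewrite pmx_path hM0.
have [[|m] /asboolP hm hmin] := ex_minnP ex.
  case: nz => i; have := hm i i; rewrite pmx0 => /(congr1 (fun A => \rank A)).
  by rewrite mxrank1 mxrank0.
have : ~ forall i j, pm m i j = 0.
  by move=> h; have := hmin m (asboolT h); rewrite ltnn.
move=> /existsNP[i /existsNP[j /eqP h]]; exists m, i, j; split=> //.
by apply: contraNeq h => /pmx_neq ->.
Qed.

End Nilpotent.

(** * Dimension vectors of stable objects *)

Section Shape.
Variables (R : realType) (k : finFieldType) (n : nat) (Z : {additive G0 n -> R[i]}).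
Hypothesis Z_stab : stability_function k Z.
Implicit Types (X Y : nilrep k n) (i j w : 'I_n).

(** Going once round the cycle is an endomorphism. Were it injective, a longest nonzero path could
    be prolonged by n. *)
Lemma stable_loop0 X : stable Z X -> forall i j, pmx X n i j = 0.
Proof.
move=> st i0 j0; have [->|/pmx_neq ->//] := eqVneq j0 (vtx i0 n).
have [||f0] := @schur R k n Z Z_stab X (fun w => pmx X n w w) st.
  by move=> w; rewrite -pmxS.
  have [m [i [j [ej nz max]]]] := longest_path st.1.
  move=> mono; case/eqP: nz; have := mono j; rewrite row_free_unit => u.
  have z : pmx X (n + m) i (vtx i m) = 0.
    by apply: (pmx_eq0_leq _ max); have := ord_gt0 i; lia.
  by subst j; rewrite -[LHS](mulKmx u) pmxD z mulmx0.
have e : vtx i0 n = i0 by rewrite -[n in vtx _ n]add0n vtxDn.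
by rewrite e; exact: f0.
Qed.

Definition arc_phase i c d : R := carg (Zdim Z (arc_dim i c d)).

Lemma stable_dim X : stable Z X -> exists i l j,
  [/\ (l < n)%N, pmx X l i j != 0, forall i j, pmx X l.+1 i j = 0 &
      forall w, rdim X w = (dist i w <= l)%N].
Proof.
move=> st; have [m [i [j [ej nz max]]]] := longest_path st.1.
have mn : (m < n)%N.
  rewrite ltnNge; apply/negP => nm; case/eqP: nz.
  exact: pmx_eq0_leq nm (stable_loop0 st) i j.
exists i, m, j; split=> //.
have [a [b ab]] : exists a b, pmx X m i j a b != 0.
  apply: contrapT => h; case/eqP: nz; apply/matrixP => a b; rewrite mxE.
  by apply: contrapT => /eqP ab; apply: h; exists a, b.
(* X_w is sent along the path to X_i, by an elementary matrix to X_j, and along the path back to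
   X_w. The indices a, b pick a nonzero entry of the path, which makes h nonzero at i. *)
pose h w := if (dist i w <= m)%N then
   pmx X (dist i w) i w *m delta_mx b a *m pmx X (m - dist i w) w j else 0.
have hh : is_hom h.
  move=> w; rewrite /h {h}; have [e|ne] := eqVneq (ordS w) i.
    subst i; rewrite dist0 leq0n subn0 -[RHS]mulmxA.
    rewrite -[pmx X m (ordS w) j *m _]/(pmx X m.+1 w j) max mulmx0.
    case: ifP => _; rewrite ?mulmx0 // !mulmxA -pmxS dist_pred // stable_loop0 //.
    by rewrite !mul0mx.
  rewrite (dist_ordS ne); have [tm|mt] := leqP (dist i w) m; last first.
    by rewrite leqNgt ltnW // mul0mx mulmx0.
  rewrite !mulmxA -pmxS; have [e|nem] := eqVneq (dist i w) m.
    by rewrite e max ltnn !mul0mx.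
  have lt : (dist i w < m)%N by rewrite ltn_neqAle nem.
  rewrite lt -[RHS]mulmxA -(subnSK lt) //.
have [mono|h0] := schur Z_stab st hh; last first.
  have := h0 i; rewrite /h dist0 leq0n subn0 pmx0 mul1mx => /matrixP/(_ b b)/eqP.
  rewrite mxE (bigD1 a) //= big1 => [|c ca]; last by rewrite !mxE (negPf ca) andbF mul0r.
  by rewrite !mxE !eqxx mul1r addr0 (negPf ab).
move=> w; have := mono w; rewrite /h /row_free; case: leqP => tm.
  move=> /eqP rk; apply/eqP; rewrite eqn_leq -{1}rk; apply/andP; split.
    apply: leq_trans (mxrankM_maxl _ _) _; apply: leq_trans (mxrankM_maxr _ _) _.
    by rewrite mxrank_delta.
  rewrite lt0n; apply: contraNneq nz => d0.
  have := @pmxD k n X (m - dist i w) (dist i w) i j.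
  rewrite vtx_dist subnK // => <-; apply/eqP.
  have -> : pmx X (dist i w) i w = 0; last by rewrite mulmx0.
  by apply/matrixP => c; case: (cast_ord d0 c).
by rewrite mxrank0 => /eqP.
Qed.

Lemma arc_dist i l w : (l <= n)%N -> arc_dim i 0 l w = (dist i w < l)%N.
Proof.
move=> ln; rewrite -{1}(vtx_dist i w); case: ltnP => lw.
  by rewrite arc_in ?add0n.
by rewrite arc_out // lw add0n dist_lt.
Qed.

Lemma stable_shape X : stable Z X -> exists i l,
  [/\ (0 < l <= n)%N, dim_of X = arc_dim i 0 l & arc_stable (arc_phase i) 0 l].
Proof.
move=> st; have [i [m [j [mn nz max dX]]]] := stable_dim st.
have dimX : dim_of X = arc_dim i 0 m.+1.
  by apply/ffunP => w; rewrite ffunE dX arc_dist.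
exists i, m.+1; split=> //; apply/arc_stableP; split=> // x xm.
(* The subobject on the first x vertices of the arc, which will have class [0, x). *)
pose W w : 'M[k]_(rdim X w) := if (dist i w < x)%N then 1%:M else 0.
have [|Y [f [hf mf dY]]] := @subrepP k n X _ W.
  move=> w; rewrite /W; case: (ltnP (dist i w) x) => [_|xw]; first exact: submx1.
  have [e|ne] := eqVneq (ordS w) i; last first.
    by rewrite (dist_ordS ne) ltnNge (leq_trans xw) // mul0mx sub0mx.
  subst i; rewrite dist0; case: ifP => [_|_]; last by rewrite mul0mx sub0mx.
  (* The arrow leaving X_i vanishes: the longest path is onto the line X_i and cannot be
     prolonged. *)
  suff -> : rmap X w = 0 by rewrite mulmx0 sub0mx.
  have full : row_full (pmx X m (ordS w) j).
    rewrite /row_full eqn_leq rank_leq_col; apply: (@leq_trans 1).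
      by rewrite dX dist0.
    by rewrite lt0n mxrank_eq0.
  have := max w j; rewrite -[pmx X m.+1 w j]/(pmx X m (ordS w) j *m _).
  have [B hB] := row_fullP full.
  by move/(congr1 (mulmx B)); rewrite mulmxA hB mul1mx mulmx0.
have dimY : dim_of Y = arc_dim i 0 x.
  apply/ffunP => w; rewrite ffunE dY arc_dist; last lia.
  rewrite /W; case: ltnP => wx; rewrite ?mxrank1 ?mxrank0 // dX.
  by rewrite (leq_trans (ltnW wx)) //; lia.
have Ynz : ~ is_zero Y.
  by move/is_zero_dim; rewrite dimY; apply/eqP/arc_neq0; lia.
have nif : ~ is_iso f.
  move/iso_rdim/(_ (vtx i m)); rewrite dY /W dX dist_vtx // leqnn ltnNge.
  have -> : (x <= m)%N by lia.
  by rewrite mxrank0.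
have := st.2 Y f hf mf nif Ynz.
by rewrite !phase_dim dimX dimY.
Qed.

End Shape.

(** * Uniserial objects of length at most n and their subobjects *)

Section Uniserial.
Variables (k : fieldType) (n : nat) (i : 'I_n) (l : nat).

(** The arrow leaving the socle i is cut. This matters for length n, where an uncut cycle would not
    be nilpotent. *)
Definition useg_rep : rep k n :=
  @Rep k n (fun w => (dist i w < l)%N : nat)
    (fun w => if ordS w == i then 0 else const_mx 1).

Lemma useg_nilpotent : nilpotent useg_rep.
Proof.
exists n => v; pose u := dist v (ord_pred i).
apply: (@path_mx_eq0 _ _ _ _ u.+1); first exact: dist_lt.
rewrite -[path_mx _ _ _]/(rmap useg_rep (vtx v u) *m path_mx useg_rep v u) /=.
have -> : ordS (vtx v u) = i by rewrite vtx_dist ord_predK.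
by rewrite eqxx mul0mx.
Qed.

Definition useg : nilrep k n := NilRep useg_nilpotent.

Lemma dim_useg : (l <= n)%N -> dim_of useg = arc_dim i 0 l.
Proof. by move=> ln; apply/ffunP => w; rewrite ffunE arc_dist. Qed.

Lemma mulmx_const1_eq0 (b1 b2 : bool) p (A : 'M[k]_(p, b1)) :
  b1 -> b2 -> A *m (const_mx 1 : 'M_(b1, b2)) = 0 -> A = 0.
Proof.
case: b1 b2 A => [] // [] // A _ _; have -> : const_mx 1 = 1%:M :> 'M[k]_1.
  by apply/matrixP => a b; rewrite !ord1 !mxE.
by rewrite mulmx1.
Qed.

(** The arrows inside the arc are injective, so a subobject that vanishes at one vertex vanishes at
    all later ones. *)
Lemma sub_useg_dim (Y : nilrep k n) (f : mxfam Y useg) : (l <= n)%N ->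
  is_hom f -> is_mono f -> exists2 x, (x <= l)%N & dim_of Y = arc_dim i 0 x.
Proof.
move=> ln hf mf.
have le w : (rdim Y w <= (dist i w < l))%N.
  by have /eqP <- := mf w; exact: rank_leq_col.
have down t : (t.+1 < l)%N -> rdim Y (vtx i t) = 0%N -> rdim Y (vtx i t.+1) = 0%N.
  move=> tl d0; pose w := vtx i t; have Sw : ordS w = vtx i t.+1 by [].
  have dS : dist i (ordS w) = t.+1 by rewrite Sw dist_vtx //; lia.
  have nei : ordS w != i by apply/eqP => e; move: dS; rewrite e dist0.
  have := hf w; rewrite /= (negPf nei).
  have -> : rmap Y w = 0 by apply/matrixP => a b; case: (cast_ord d0 b).
  rewrite mul0mx => /esym/mulmx_const1_eq0 f0.
  rewrite -[LHS]/(rdim Y (ordS w)); apply/eqP.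
  have /eqP <- := mf (ordS w); rewrite mxrank_eq0 f0 //.
    by rewrite dS.
  by rewrite dist_vtx; lia.
pose P x := (l <= x)%N || (rdim Y (vtx i x) == 0%N).
have exP : exists x, P x by exists l; rewrite /P leqnn.
have [x Px xmin] := ex_minnP exP.
have xl : (x <= l)%N by apply: xmin; rewrite /P leqnn.
exists x => //; apply/ffunP => w; rewrite ffunE arc_dist ?(leq_trans xl) //.
have [wx|xw] := ltnP (dist i w) x.
  apply/eqP; rewrite eqn_leq (leq_trans (le w)) ?leq_b1 // lt0n.
  apply/negP => d0; have := xmin (dist i w); rewrite /P vtx_dist d0 orbT.
  by rewrite leqNgt wx => /(_ isT).
have [wl|lw] := ltnP (dist i w) l; last by apply/eqP; have := le w; rewrite ltnNge lw; lia.
have zero t : (x + t < l)%N -> rdim Y (vtx i (x + t)) = 0%N.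
  elim: t => [|t IH] tl.
    by move: Px tl; rewrite addn0 /P => /orP[|/eqP //]; lia.
  by rewrite addnS; apply: down; [lia|apply: IH; lia].
by have := zero (dist i w - x)%N; rewrite subnKC // vtx_dist => ->.
Qed.

End Uniserial.

Section UniserialStable.
Variables (R : realType) (k : finFieldType) (n : nat) (Z : {additive G0 n -> R[i]}).

Lemma useg_stable i l : (0 < l <= n)%N -> arc_stable (arc_phase Z i) 0 l ->
  stable Z (useg k i l).
Proof.
move=> /andP[l0 ln] /arc_stableP[_ st]; split.
  by move/is_zero_dim; rewrite dim_useg //; apply/eqP/arc_neq0.
move=> Y f hf mf nif Ynz; have [x xl dY] := sub_useg_dim ln hf mf.
rewrite !phase_dim dim_useg // dY; apply: st.
have x0 : (0 < x)%N.
  rewrite lt0n; apply/eqP => x0; apply: Ynz; apply/is_zero_dim.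
  by rewrite dY x0 /arc_dim big_geq.
rewrite x0 ltn_neqAle xl andbT; apply/eqP => xE; apply: nif.
have dE w : rdim Y w = rdim (useg k i l) w.
  by move/ffunP/(_ w): dY; rewrite xE -(dim_useg k) // !ffunE.
have full w : row_full (f w).
  by apply/eqP; apply: etrans (dE w); exact/eqP/mf.
exists (fun w => pinvmx (f w)).
have fg w : f w *m pinvmx (f w) = 1%:M by apply: mulmxVp.
have gf w : pinvmx (f w) *m f w = 1%:M by apply: mulVpmx.
by split=> //; apply: is_iso_inv hf _ fg gf.
Qed.

End UniserialStable.

(** * The product over the stable objects *)

Lemma exists_argmin (R : realDomainType) (f : nat -> R) N : (0 < N)%N ->
  exists2 c, (c < N)%N & forall t, (t < N)%N -> f c <= f t.
Proof.
elim: N => [//|[|N] IH] _.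
  by exists 0%N => // t; rewrite ltnS leqn0 => /eqP ->.
have [c cN cmin] := IH isT.
have [le|lt] := leP (f c) (f N.+1).
  exists c; first exact: leqW.
  by move=> t; rewrite ltnS leq_eqVlt => /predU1P[->//|]; exact: cmin.
exists N.+1 => // t; rewrite ltnS leq_eqVlt => /predU1P[->//|tN].
exact: le_trans (ltW lt) (cmin t tN).
Qed.

Section ArcShift.
Variable n : nat.
Implicit Type s : 'I_n.

Lemma arc_vtx s c a b : arc_dim (vtx s c) a b = arc_dim s (c + a) (c + b).
Proof.
elim: c a b => [|c IH] a b //.
by rewrite -[vtx s c.+1]/(ordS (vtx s c)) arc_dim_ordS IH !addnS !addSn.
Qed.

Lemma arc_mem s c d t : (c < d <= n)%N -> (t < n)%N ->
  arc_dim s c d (vtx s t) = (c <= t < d)%N.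
Proof.
move=> cd tn; have [tc|ct] := ltnP t c; first by rewrite -vtxDn arc_out //; lia.
by have [td|dt] := ltnP t d; [rewrite arc_in|rewrite arc_out]; lia.
Qed.

Lemma arc_inj s c d c' d' : (c < d <= n)%N -> (c' < d' <= n)%N ->
  arc_dim s c d = arc_dim s c' d' -> (c, d) = (c', d').
Proof.
move=> cd cd' /ffunP e.
have mem t : (t < n)%N -> (c <= t < d)%N = (c' <= t < d')%N.
  (* Both coefficients are booleans read as numbers; [odd] recovers them. *)
  by move=> tn; have := e (vtx s t); rewrite !arc_mem // => /(congr1 odd); rewrite !oddb.
have := mem c ltac:(lia); have := mem c' ltac:(lia).
have := mem d.-1 ltac:(lia); have := mem d'.-1 ltac:(lia).
by move=> *; congr (_, _); lia.
Qed.

Lemma arc_neq_delta s c d : (c < d)%N -> (d < c + n)%N -> arc_dim s c d <> delta n.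
Proof.
move=> cd dn /ffunP/(_ (vtx s d)).
by rewrite arc_out ?ffunE // dn leqnn.
Qed.

End ArcShift.

(** * Consequences of discreteness, and the list of stable arcs *)

Section Discrete.
Variables (R : realType) (k : finFieldType) (n : nat) (Z : {additive G0 n -> R[i]}).
Hypothesis Z_stab : stability_function k Z.
Hypothesis Z_disc : discrete k Z.
Implicit Types (X Y : nilrep k n) (s : 'I_n).
Local Notation phi := (arc_phase Z).

Lemma isomorphic_sym X Y : isomorphic X Y -> isomorphic Y X.
Proof.
case=> f [hf [g [hg fg gf]]]; exists g; split=> //.
by exists f; split.
Qed.

Lemma isomorphic_trans X Y W : isomorphic X Y -> isomorphic Y W -> isomorphic X W.
Proof.
case=> f [hf [g [hg fg gf]]] [f' [hf' [g' [hg' fg' gf']]]].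
exists (fun i => f i *m f' i); split.
  by move=> i; rewrite mulmxA hf -mulmxA hf' mulmxA.
exists (fun i => g' i *m g i); split=> i.
- by rewrite mulmxA hg' -mulmxA hg mulmxA.
- by rewrite mulmxA -(mulmxA (f i)) fg' mulmx1 fg.
- by rewrite mulmxA -(mulmxA (g' i)) gf mulmx1 gf'.
Qed.

Lemma isomorphic_dim X Y : isomorphic X Y -> dim_of X = dim_of Y.
Proof.
by case=> f [_ /iso_rdim e]; apply/ffunP => i; rewrite !ffunE e.
Qed.

Lemma stable_slice_simple X : stable Z X -> slice_simple Z (phase Z X) X.
Proof.
move=> [nz st]; split=> //.
  right; split=> //; split=> // Y f hf mf nif Ynz.
  by apply: ltW; exact: st hf mf nif Ynz.
move=> Y f [z|[_ pY]] hf mf; first by left.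
apply: contrapT => /not_orP[Ynz nif].
by have := st Y f hf mf nif Ynz; rewrite pY ltxx.
Qed.

Lemma stable_phase_inj X Y : stable Z X -> stable Z Y -> phase Z X = phase Z Y ->
  isomorphic X Y.
Proof.
move=> sX sY e; have [_ pb] := Z_stab sX.1.
case: (Z_disc pb) => [h|[S [_ uniS]]].
  by have [iX nzX _] := stable_slice_simple sX; case: nzX; exact: h.
apply: (isomorphic_trans (uniS _ (stable_slice_simple sX))).
by apply/isomorphic_sym/uniS; rewrite e; exact: stable_slice_simple.
Qed.

Lemma phi_seesaw s : seesaw (phi s).
Proof.
move=> c x d /andP[cx xd]; rewrite /arc_phase -(@arcD _ s c x d) ?ZdimD; last lia.
apply: carg_seesaw; rewrite -?ZdimD ?arcD; try lia;
  by apply: (upper_Zdim Z_stab); apply: arc_neq0; lia.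
Qed.

Lemma phi_vtx s c a b : phi (vtx s c) a b = phi s (c + a) (c + b).
Proof. by rewrite /arc_phase arc_vtx. Qed.

Lemma arc_stable_vtx s c l :
  arc_stable (phi (vtx s c)) 0 l = arc_stable (phi s) c (c + l).
Proof.
apply/arc_stableP/arc_stableP => -[l0 st]; split; try lia.
  move=> x xb; have := st (x - c)%N ltac:(lia).
  by rewrite !phi_vtx addn0 subnKC //; lia.
by move=> x xb; have := st (c + x)%N ltac:(lia); rewrite !phi_vtx addn0.
Qed.

Definition arc_obj s (L : nat * nat) : nilrep k n := useg k (vtx s L.1) (L.2 - L.1).

Lemma dim_arc_obj s c d : (c < d <= c + n)%N -> dim_of (arc_obj s (c, d)) = arc_dim s c d.
Proof.
by move=> cd; rewrite dim_useg /= ?arc_vtx ?addn0 ?subnKC //; lia.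
Qed.

Lemma phase_arc_obj s c d : (c < d <= c + n)%N -> phase Z (arc_obj s (c, d)) = phi s c d.
Proof. by move=> cd; rewrite phase_dim dim_arc_obj. Qed.

Lemma arc_obj_stable s c d : (c < d <= c + n)%N -> arc_stable (phi s) c d ->
  stable Z (arc_obj s (c, d)).
Proof.
move=> cd st; apply: useg_stable; first by rewrite /=; lia.
by rewrite arc_stable_vtx /= subnKC //; lia.
Qed.

(* The height of t is a cross product of Z[0, t) with Z(delta); it is periodic, *)
(* and [c, c + n) is stable when c is its strict minimum over a period.         *)
Lemma exists_stable_delta : (0 < n)%N -> exists s, arc_stable (phi s) 0 n.
Proof.
move=> n0; pose s := Ordinal n0; pose D := Zdim Z (delta n).
pose hgt t := cross (Zdim Z (arc_dim s 0 t)) D.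
have hgtB c d : (c <= d)%N -> cross (Zdim Z (arc_dim s c d)) D = hgt d - hgt c.
  by move=> cd; rewrite /hgt -(@arcD _ s 0 c d) // ZdimD crossDl addrC addKr.
have uD : upper D.
  by rewrite /D -(arc_full s); apply/(upper_Zdim Z_stab)/arc_neq0.
have hgtDn t : hgt (t + n)%N = hgt t.
  apply/eqP; rewrite -subr_eq0 -hgtB ?leq_addr // -(addn0 t) -addnA.
  by rewrite -arc_vtx add0n arc_full crosszz.
have pD c : phi s c (c + n) = carg D.
  by rewrite /arc_phase -{1}(addn0 c) -arc_vtx arc_full.
have uphi c d : (c < d)%N -> upper (Zdim Z (arc_dim s c d)).
  by move=> cd; apply/(upper_Zdim Z_stab)/arc_neq0.
have phi_lt c d : (c < d)%N -> (phi s c d < carg D) = (hgt c < hgt d).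
  by move=> cd; rewrite /arc_phase carg_lt ?hgtB ?subr_gt0 //; [exact: ltnW|exact: uphi].
have phi_le c d : (c < d)%N -> hgt c <= hgt d -> phi s c d <= carg D.
  move=> cd; rewrite le_eqVlt => /predU1P[e|h]; last by apply: ltW; rewrite phi_lt.
  rewrite le_eqVlt /arc_phase carg_eq ?hgtB ?e ?subrr ?eqxx //; last exact: uphi.
  exact: ltnW.
have [c cn cmin] : exists2 c, (c < n)%N & forall t, hgt c <= hgt t.
  have [c cn cmin] := exists_argmin hgt n0.
  exists c => // t; suff -> : hgt t = hgt (t %% n)%N by rewrite cmin // ltn_mod.
  rewrite {1}(divn_eq t n); elim: (t %/ n)%N => [|a IH] //.
  by rewrite mulSn -addnA addnC hgtDn.
exists (vtx s c); rewrite arc_stable_vtx; apply/arc_stableP; split; first lia.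
move=> x xb; rewrite pD phi_lt ?lt_neqAle ?cmin ?andbT; last lia.
apply/eqP => ex.
(* If the minimum were attained again at x, both [c, x) and [x, c+n) would have the phase of delta,
   and each would have a stable prefix of that phase. One prefix contains the vertex c and the other
   does not, against discreteness. *)
have stab_at a b : (c <= a < b)%N -> (b <= c + n)%N -> hgt a = hgt c -> hgt b = hgt c ->
   exists2 z, (a < z <= b)%N & arc_stable (phi s) a z /\ phi s a z = carg D.
  move=> ab bn ea eb; have yb : (a < b <= b)%N by lia.
  have pab : phi s a b = carg D.
    apply/eqP; rewrite /arc_phase carg_eq ?hgtB ?ea ?eb ?subrr ?eqxx //; try lia.
    by apply: uphi; lia.
  have lt1 : phi s a b - 1 < phi s a b by rewrite ltrBlDr ltrDl ltr01.
  have [z zb [st _ max]] := stable_prefix yb lt1.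
  exists z => //; split=> //; apply/eqP; rewrite eq_le -{2}pab max // andbT.
  by apply: phi_le; [lia|rewrite ea cmin].
have [z zb [stz pz]] := stab_at c x ltac:(lia) ltac:(lia) erefl (esym ex).
have [z' zb' [stz' pz']] := stab_at x (c + n)%N ltac:(lia) (leqnn _) (esym ex) (hgtDn c).
have zn : (c < z <= c + n)%N by lia.
have zn' : (x < z' <= x + n)%N by lia.
have pe : phase Z (arc_obj s (c, z)) = phase Z (arc_obj s (x, z')).
  by rewrite !phase_arc_obj // pz pz'.
have := isomorphic_dim (stable_phase_inj (arc_obj_stable zn stz) (arc_obj_stable zn' stz') pe).
rewrite !dim_arc_obj // => /ffunP/(_ (vtx s c)).
rewrite arc_in ?leqnn; try lia.
by rewrite -(vtxDn s c) arc_out //; lia.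
Qed.

Section DeltaStable.
Variable s : 'I_n.
Hypothesis s_delta : arc_stable (phi s) 0 n.

(* If a stable [c, d) passed over n, its prefix [c, n), a suffix of [0, n),     *)
(* would have phase > phi 0 n, and its suffix [n, d), i.e. [0, d - n), a        *)
(* smaller one.                                                                 *)
Lemma stable_arc X : stable Z X -> dim_of X <> delta n -> exists c d,
  [/\ (c < d <= n)%N, (c, d) != (0, n)%N, arc_stable (phi s) c d & dim_of X = arc_dim s c d].
Proof.
move=> sX dX; have [i [l [lb dimX st]]] := stable_shape Z_stab sX.
have [c cn iE] := vtx_surj s i.
have ln : (l < n)%N.
  rewrite ltn_neqAle; apply/andP; split; last by lia.
  by apply/eqP => e; apply: dX; rewrite dimX e arc_full.
have st' : arc_stable (phi s) c (c + l) by rewrite -arc_stable_vtx -iE.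
have dimX' : dim_of X = arc_dim s c (c + l) by rewrite dimX iE arc_vtx addn0.
have dn : (c + l <= n)%N.
  rewrite leqNgt; apply/negP => nd.
  have sub : (c < n < c + l)%N by rewrite cn.
  have q := stable_quotient (@phi_seesaw s) st' sub.
  have p := (arc_stableP _ _ _ st').2 _ sub.
  have pre : phi s n (c + l) < phi s 0 n.
    have -> : phi s n (c + l) = phi s 0 (c + l - n).
      rewrite /arc_phase -(arcDn s 0) add0n subnK //; exact: ltnW.
    by apply: (arc_stableP _ _ _ s_delta).2; lia.
  have suf : phi s 0 n < phi s c n.
    by apply: (stable_quotient (@phi_seesaw s) s_delta); lia.
  by have := lt_trans (lt_trans suf p) (lt_trans q pre); rewrite ltxx.
exists c, (c + l)%N; split=> //; first lia.
by apply/eqP => -[]; lia.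
Qed.

Lemma EZ_Ecyc m (L : 'I_m -> nilrep k n) : (1 < n)%N -> stable_listing Z L ->
  EZ L = Ecyc k s.
Proof.
move=> n1 [stL compl ord].
have arcL i := stable_arc (stL i).1 (stL i).2.
have {arcL} /choice[A hA] : forall i, exists M : nat * nat, [/\ (M.1 < M.2 <= n)%N, M != (0, n)%N,
    arc_stable (phi s) M.1 M.2 & dim_of (L i) = arc_dim s M.1 M.2].
  by move=> i; have [c [d [h1 h2 h3 h4]]] := arcL i; exists (c, d).
have pA i : phase Z (L i) = phi s (A i).1 (A i).2.
  by have [_ _ _ dA] := hA i; rewrite phase_dim dA.
transitivity (\prod_(M <- map A (enum 'I_m)) Earc k s M.1 M.2).
  rewrite big_map enumT /EZ [index_enum _]unlock; apply: eq_bigr => i _.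
  by have [_ _ _ dA] := hA i; rewrite /Earc -dA.
apply: (@stable_prod R (qtorus k n) n (phi s) (Earc k s)) => //.
- exact: phi_seesaw.
- exact: ltnW.
- exact: Earc_unit.
- exact: Earc_pentagon.
- exact: Earc_disjoint.
- exact: Earc_nested.
- rewrite sorted_map; apply: (@sub_sorted _ (relpre val ltn)).
    by move=> i j /= ij; rewrite -!pA; exact: ord.
  by rewrite -sorted_map val_enum_ord iota_ltn_sorted.
move=> c d; apply/mapP/and3P => [[i _ e]|[dn ne st]].
  by have [h1 h2 h3 _] := hA i; move: h1 h2 h3; rewrite -e /= => /andP[_ ->].
have [cd _] := arc_stableP _ _ _ st.
(* Excluding [0, n) leaves arcs shorter than n; their classes differ from delta, so the listing
   contains them. *)
have lt : (d < c + n)%N.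
  by case: c ne {st} cd => [|c] ne cd; [case: ltngtP dn ne => // ->; rewrite eqxx|lia].
have cdn : (c < d <= c + n)%N by lia.
have [|i iso] := compl _ (arc_obj_stable cdn st).
  by rewrite dim_arc_obj //; exact: arc_neq_delta.
exists i; first by rewrite mem_enum.
have := isomorphic_dim iso; rewrite dim_arc_obj //.
have [h1 _ _ ->] := hA i; rewrite [A i]surjective_pairing.
by move/arc_inj; apply => //; lia.
Qed.

Lemma exists_stable_listing : exists m (L : 'I_m -> nilrep k n), stable_listing Z L.
Proof.
pose good (M : nat * nat) := (M != (0, n)%N) && arc_stable (phi s) M.1 M.2.
pose ps := [seq M <- [seq (c, d) | c <- iota 0 n, d <- iota 0 n.+1] | good M].
pose ge (M N : nat * nat) := phi s N.1 N.2 <= phi s M.1 M.2.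
pose ss := sort ge ps.
have ssP c d : ((c, d) \in ss) = [&& (c < d <= n)%N, (c, d) != (0, n)%N &
    arc_stable (phi s) c d].
  rewrite mem_sort mem_filter andbC; apply/andP/and3P.
    case=> /allpairsP[[a b] [_ hb /= [-> ->]]] /andP[ne st]; split=> //.
    by have [ab _] := arc_stableP _ _ _ st; move: hb; rewrite mem_iota ab /=; lia.
  case=> cd ne st; rewrite /good ne st; split=> //.
  by apply/allpairsP; exists (c, d); rewrite !mem_iota; split=> //=; lia.
have ss_uniq : uniq ss.
  rewrite sort_uniq filter_uniq // allpairs_uniq ?iota_uniq // => -[a b] [a' b'] _ _ /=.
  by case=> -> ->.
have ss_sorted : sorted ge ss by apply: sort_sorted => M N; exact: le_total.
have ge_trans : transitive ge by move=> M N O h1 h2; exact: le_trans h2 h1.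
have nthP (i : 'I_(size ss)) : exists c d, [/\ nth (0, 0)%N ss i = (c, d),
    (c < d <= n)%N, (c < d <= c + n)%N, (d < c + n)%N & arc_stable (phi s) c d].
  have := mem_nth (0, 0)%N (ltn_ord i); case: (nth _ _ _) => c d.
  rewrite ssP => /and3P[cd ne st]; exists c, d; split=> //; first lia.
  case: c ne {st} cd => [|c] ne cd; last lia.
  rewrite ltn_neqAle; apply/andP; split; last lia.
  by apply: contraNneq ne => ->.
exists (size ss), (fun i => arc_obj s (nth (0, 0)%N ss i)); split.
- move=> i; have [c [d [-> _ cd dn st]]] := nthP i.
  by split; [exact: arc_obj_stable|rewrite dim_arc_obj //; apply: arc_neq_delta; lia].
- move=> X sX dX; have [c [d [cd ne st dimX]]] := stable_arc sX dX.
  have cdn : (c < d <= c + n)%N by lia.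
  have inss : (c, d) \in ss by rewrite ssP cd ne.
  have lt : (index (c, d) ss < size ss)%N by rewrite index_mem.
  exists (Ordinal lt); rewrite /= nth_index //.
  apply: stable_phase_inj => //; first exact: arc_obj_stable.
  by rewrite phase_arc_obj // phase_dim dimX.
move=> i j ij; have [c [d [ei cdi cd dn st]]] := nthP i.
have [c' [d' [ej cdj cd' dn' st']]] := nthP j.
have := sorted_ltn_nth ge_trans (0, 0)%N ss_sorted i j (ltn_ord i) (ltn_ord j) ij.
rewrite /ge ei ej /= !phase_arc_obj // lt_neqAle => -> ; rewrite andbT.
(* Sorting gives only weakly decreasing phases. A tie would make two listed objects isomorphic,
   hence their arcs equal. *)
apply/negP => /eqP e.
have pe : phase Z (arc_obj s (c, d)) = phase Z (arc_obj s (c', d')).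
  by rewrite !phase_arc_obj.
have := isomorphic_dim (stable_phase_inj (arc_obj_stable cd st) (arc_obj_stable cd' st') pe).
rewrite !dim_arc_obj // => /(arc_inj cdi cdj); rewrite -ei -ej => /eqP.
by rewrite nth_uniq // => /eqP eij; move: ij; rewrite eij ltnn.
Qed.

End DeltaStable.
End Discrete.

Theorem theorem3p6 (R : realType) (k : finFieldType) (n : nat) (n_gt0 : (0 < n)%N)
    (Z : {additive G0 n -> R[i]}) :
  stability_function k Z -> discrete k Z ->
  (exists (m : nat) (L : 'I_m -> nilrep k n), stable_listing Z L) /\
  forall (m : nat) (L : 'I_m -> nilrep k n), stable_listing Z L ->
    forall j : nat, (j < n)%N -> EZ L = iter j (@tau k n) (EZ L).
Proof.
move=> Z_stab Z_disc.
have [s s_delta] := exists_stable_delta Z_stab Z_disc n_gt0.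
split=> [|m L listL [//|j] jn]; first exact: exists_stable_listing s_delta.
(* The case j = 0 is closed by reflexivity, and j > 0 excludes n = 1. *)
have n1 : (1 < n)%N by exact: leq_ltn_trans jn.
by rewrite iter_fix // (EZ_Ecyc Z_stab s_delta n1 listL) tau_Ecyc_invariant.
Qed.
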